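(* Let $\mathbb{F}$ be a field with $\operatorname{char}\mathbb{F}\neq 2,3$, let $A$ and $B$ be countable-dimensional unital locally matrix $\mathbb{F}$-algebras, and let $s=\mathbf{st}(A)$ be the Steinitz number of $A$. Identify $A$ with the algebra of periodic matrices $M_s^p(\mathbb{F})$ and let $t$ denote the transpose on $A=M_s^p(\mathbb{F})$. For an arbitrary isomorphism of multiplicative groups $\varphi:A^{*}\to B^{*}$ there exist a central homothety $\chi:A^{*}/[A^{*},A^{*}]\to\mathbb{F}^{*}$ and an isomorphism of rings $\theta:A\to B$ such that $$\varphi(g)=\chi(g)\,\theta(g)\quad\text{for all } g\in A^{*},$$ or $$\varphi(g)=\chi(g)\,\theta\big((g^{-1})^t\big)\quad\text{for all } g\in A^{*}.$$
   Context: An associative $\mathbb{F}$-algebra $A$ with unit $1$ is a unital locally matrix algebra if for every finite collection $a_1,\ldots,a_t\in A$ there is a subalgebra $A'\subset A$ with $1,a_1,\ldots,a_t\in A'$ and $A'\cong M_n(\mathbb{F})$ for some $n\in\mathbb{N}$ (positive integers). ''Countable-dimensional'' means of at most countable dimension over $\mathbb{F}$. $A^{*}$ denotes the group of invertible elements of $A$, and $[A^{*},A^{*}]$ its commutator subgroup. A central homothety of $A^{*}$ is a multiplicative group homomorphism $\chi:A^{*}/[A^{*},A^{*}]\to\mathbb{F}^{*}$; for $g\in A^{*}$, $\chi(g)$ denotes the value of $\chi$ on the coset of $g$. Ring isomorphisms are not required to be $\mathbb{F}$-linear. A Steinitz number is a formal product $\prod_{p}p^{r_p}$ over all primes $p$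 with $r_p\in\mathbb{N}\cup\{0,\infty\}$; Steinitz numbers are multiplied by adding exponents (with $\infty$ absorbing), and $s_2\mid s_1$ if $s_1=s_2s_3$ for some Steinitz number $s_3$. Let $D(A)$ be the set of positive integers $n$ such that there is a subalgebra $A'$ with $1\in A'\subset A$ and $A'\cong M_n(\mathbb{F})$; the Steinitz number $\mathbf{st}(A)$ is the least common multiple of $D(A)$ (the exponent of each prime $p$ is the supremum of its exponents in elements of $D(A)$). An $(\mathbb{N}\times\mathbb{N})$-matrix over $\mathbb{F}$ is $n$-periodic if it is block-diagonal of the form $\operatorname{diag}(a,a,\ldots)$ with $a\in M_n(\mathbb{F})$. $M_n^p(\mathbb{F})\cong M_n(\mathbb{F})$ is the algebra of all $n$-periodic matrices, and $M_s^p(\mathbb{F})=\bigcup_{n\mid s}M_n^p(\mathbb{F})$, the union over positive integers $n$ dividing $s$. This algebra is invariant under the matrix transpose $t$, which is an anti-isomorphism of it onto itself. By a theorem of Glimm, every countable-dimensional unital locally matrix algebra $A$ is isomorphic as an $\mathbb{F}$-algebra to $M_s^p(\mathbb{F})$ with $s=\mathbf{st}(A)$; the identification of $A$ with $M_s^p(\mathbb{F})$ is through a fixed such isomorphism $\iota$, so that $a^t=\iota^{-1}(\iota(a)^t)$ for $a\in A$. *)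

(* Defs.v *)
From HB Require Import structures.
From mathcomp Require Import all_boot all_order all_algebra.
From mathcomp Require Import boolp classical_sets functions fsbigop.
From mathcomp Require Import generic_quotient.

Set Implicit Arguments.
Unset Strict Implicit.
Unset Printing Implicit Defensive.

Import GRing.Theory.

Local Open Scope ring_scope.
Local Open Scope classical_set_scope.
Local Open Scope quotient_scope.

Section UnitGroup.
Variable R : unitRingType.

Record unit_group := UnitGroup { uval : R; uvalP : uval \is a GRing.unit }.

HB.instance Definition _ := [isSub for uval].
HB.instance Definition _ := [Choice of unit_group by <:].

Implicit Types u v w : unit_group.

Definition ug_one : unit_group := UnitGroup (@GRing.unitr1 R).

Fact ug_inv_subproof u : (uval u)^-1 \is a GRing.unit.
Proof. by rewrite unitrV uvalP. Qed.
Definition ug_inv u : unit_group := UnitGroup (ug_inv_subproof u).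

Fact ug_mul_subproof u v : uval u * uval v \is a GRing.unit.
Proof. by rewrite unitrMr uvalP. Qed.
Definition ug_mul u v : unit_group := UnitGroup (ug_mul_subproof u v).

Fact ug_mulA : associative ug_mul.
Proof. by move=> u v w; apply/val_inj/mulrA. Qed.
Fact ug_mul1g : left_id ug_one ug_mul.
Proof. by move=> u; apply/val_inj/mul1r. Qed.
Fact ug_mulg1 : right_id ug_one ug_mul.
Proof. by move=> u; apply/val_inj/mulr1. Qed.
Fact ug_mulVg : left_inverse ug_one ug_inv ug_mul.
Proof. by move=> u; apply/val_inj/mulVr/uvalP. Qed.
Fact ug_mulgV : right_inverse ug_one ug_inv ug_mul.
Proof. by move=> u; apply/val_inj/mulrV/uvalP. Qed.

HB.instance Definition _ :=
  isGroup.Build unit_group ug_mulA ug_mul1g ug_mulg1 ug_mulVg ug_mulgV.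

Lemma uval1 : uval 1%g = 1. Proof. by []. Qed.
Lemma uvalM u v : uval (u * v)%g = uval u * uval v. Proof. by []. Qed.
Lemma uvalV u : uval u^-1%g = (uval u)^-1. Proof. by []. Qed.

End UnitGroup.

Section Abelianization.
Variable G : groupType.
Implicit Types (x y z : G) (H : {pred G}).
Local Open Scope group_scope.

(* The least subgroup of G containing all commutators. *)
Definition commutator_subgroup : {pred G} :=
  [pred x | `[< forall H, group_closed H ->
                  (forall a b, [~ a, b] \in H) -> x \in H >]].

Fact commutator_subgroup_closed : group_closed commutator_subgroup.
Proof.
split=> [|x y /asboolP Hx /asboolP Hy]; apply/asboolP=> H HH HC.
  by case: HH.
by apply: HH.2; [apply: Hx | apply: Hy].
Qed.

Fact commutator_subgroup_comm a b : [~ a, b] \in commutator_subgroup.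
Proof. by apply/asboolP => H _; apply. Qed.

Let cs1 := commutator_subgroup_closed.1.
Let csF := commutator_subgroup_closed.2.

Fact csV x : x \in commutator_subgroup -> x^-1 \in commutator_subgroup.
Proof. by move=> Hx; rewrite -[x^-1]mul1g; apply: csF. Qed.

Fact csM x y : x \in commutator_subgroup -> y \in commutator_subgroup ->
  x * y \in commutator_subgroup.
Proof. by move=> Hx Hy; rewrite -[y]invgK; apply: csF => //; apply: csV. Qed.

Fact csJ x y : x \in commutator_subgroup -> x ^ y \in commutator_subgroup.
Proof.
move=> Hx; have -> : x ^ y = x * [~ x, y] by rewrite /commg mulgA mulgV mul1g.
by apply: csM => //; apply: commutator_subgroup_comm.
Qed.

(* x and y lie in the same (left) coset of [G, G]. *)
Definition coset_rel : rel G := fun x y => x^-1 * y \in commutator_subgroup.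

Fact coset_rel_refl : reflexive coset_rel.
Proof. by move=> x; rewrite /coset_rel mulVg. Qed.

Fact coset_rel_sym : symmetric coset_rel.
Proof.
have sub x y : coset_rel x y -> coset_rel y x.
  by rewrite /coset_rel => /csV; rewrite invgM invgK.
by move=> x y; apply/idP/idP; apply: sub.
Qed.

Fact coset_rel_trans : transitive coset_rel.
Proof.
rewrite /coset_rel => y x z Hxy Hyz.
have -> : x^-1 * z = (x^-1 * y) * (y^-1 * z) by rewrite mulgA mulgK.
exact: csM.
Qed.

Canonical coset_equiv :=
  EquivRel coset_rel coset_rel_refl coset_rel_sym coset_rel_trans.

Definition abelianization := {eq_quot coset_equiv}.

HB.instance Definition _ := Choice.on abelianization.
HB.instance Definition _ := EqQuotient.on abelianization.

Definition ab_class (x : G) : abelianization := \pi_abelianization x.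

Fact ab_classP x y :
  reflect (ab_class x = ab_class y) (x^-1 * y \in commutator_subgroup).
Proof. exact: (@eqmodP _ coset_equiv). Qed.

Fact ab_class_repr (X : abelianization) : ab_class (repr X) = X.
Proof. exact: reprK. Qed.

Definition ab_one : abelianization := ab_class 1.
Definition ab_inv (X : abelianization) := ab_class (repr X)^-1.
Definition ab_mul (X Y : abelianization) := ab_class (repr X * repr Y).

Fact ab_classM x y : ab_mul (ab_class x) (ab_class y) = ab_class (x * y).
Proof.
have /ab_classP hx := ab_class_repr (ab_class x).
have /ab_classP hy := ab_class_repr (ab_class y).
apply/ab_classP; set a := repr _ in hx *; set b := repr _ in hy *.
have -> : (a * b)^-1 * (x * y) = (a^-1 * x) ^ b * (b^-1 * y).
  by rewrite /conjg invgM !mulgA mulgK.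
by apply: csM => //; apply: csJ.
Qed.

Fact ab_classV x : ab_inv (ab_class x) = ab_class x^-1.
Proof.
have /ab_classP hx := ab_class_repr (ab_class x).
apply/ab_classP; set a := repr _ in hx *.
have -> : a^-1^-1 * x^-1 = ((a^-1 * x)^-1) ^ a^-1.
  by rewrite /conjg !invgM !invgK !mulgA mulgK.
exact/csJ/csV.
Qed.

Fact ab_mulA : associative ab_mul.
Proof.
move=> X Y Z; rewrite -(ab_class_repr X) -(ab_class_repr Y) -(ab_class_repr Z).
by rewrite !ab_classM mulgA.
Qed.
Fact ab_mul1g : left_id ab_one ab_mul.
Proof. by move=> X; rewrite -(ab_class_repr X) ab_classM mul1g. Qed.
Fact ab_mulg1 : right_id ab_one ab_mul.
Proof. by move=> X; rewrite -(ab_class_repr X) ab_classM mulg1. Qed.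
Fact ab_mulVg : left_inverse ab_one ab_inv ab_mul.
Proof. by move=> X; rewrite -(ab_class_repr X) ab_classV ab_classM mulVg. Qed.
Fact ab_mulgV : right_inverse ab_one ab_inv ab_mul.
Proof. by move=> X; rewrite -(ab_class_repr X) ab_classV ab_classM mulgV. Qed.

HB.instance Definition _ :=
  isGroup.Build abelianization ab_mulA ab_mul1g ab_mulg1 ab_mulVg ab_mulgV.

Fact ab_class_multiplicative : {morph ab_class : x y / x * y}.
Proof. by move=> x y; rewrite -ab_classM. Qed.
HB.instance Definition _ :=
  isMultiplicative.Build G abelianization ab_class ab_class_multiplicative.

End Abelianization.

Section Steinitz.

(* Exponents live in N u {oo}: Some r is r, None is oo. *)
Definition steinitz := {p : nat | prime p} -> option nat.

Definition exponent_add (e f : option nat) : option nat :=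
  if (e, f) is (Some a, Some b) then Some (a + b)%N else None.

Definition steinitz_mul (s1 s2 : steinitz) : steinitz :=
  fun p => exponent_add (s1 p) (s2 p).

Definition steinitz_dvd (s2 s1 : steinitz) : Prop :=
  exists s3, s1 = steinitz_mul s2 s3.

Definition steinitz_of_nat (n : nat) : steinitz := fun p => Some (logn (val p) n).

(* Least upper bound in N u {oo}. *)
Definition exponent_sup (S : set nat) : option nat :=
  if pselect (exists m, `[< forall n, S n -> (n <= m)%N >]) is left ex_ub
  then Some (ex_minn ex_ub) else None.

Definition steinitz_lcm (D : set nat) : steinitz :=
  fun p => exponent_sup [set logn (val p) n | n in D].

Definition nat_dvd_steinitz (n : nat) (s : steinitz) : Prop :=
  (0 < n)%N /\ steinitz_dvd (steinitz_of_nat n) s.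

Fact nat_dvd_steinitzP n s : nat_dvd_steinitz n s <->
  (0 < n)%N /\
  forall p, if s p is Some e then (logn (val p) n <= e)%N else true.
Proof.
split=> -[n_gt0 Hn]; split=> //.
  case: Hn => s3 -> p; rewrite /steinitz_mul /=.
  by case: (s3 p) => //= e; rewrite leq_addr.
exists (fun p => if s p is Some e then Some (e - logn (val p) n)%N else None).
apply/funext => p; rewrite /steinitz_mul /=; move: (Hn p).
by case: (s p) => //= e le_e; rewrite /exponent_add /= subnKC.
Qed.

Fact nat_dvd_steinitz1 s : nat_dvd_steinitz 1 s.
Proof. by apply/nat_dvd_steinitzP; split=> // p; case: (s p); rewrite ?logn1. Qed.

Fact nat_dvd_steinitz_lcm m n s :
  nat_dvd_steinitz m s -> nat_dvd_steinitz n s -> nat_dvd_steinitz (lcmn m n) s.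
Proof.
move=> /nat_dvd_steinitzP[m0 Hm] /nat_dvd_steinitzP[n0 Hn].
apply/nat_dvd_steinitzP; split; first by rewrite lcmn_gt0 m0.
move=> p; move: (Hm p) (Hn p); rewrite logn_lcm //.
by case: (s p) => // e; rewrite geq_max => -> ->.
Qed.

End Steinitz.

Section InfiniteMatrices.
Variable F : fieldType.
Implicit Types M N : nat -> nat -> F.

(* Entrywise sum over all of N; by convention a sum with infinite support is 0,
   a case that does not occur for block-diagonal matrices. *)
Definition infmx_mul M N : nat -> nat -> F :=
  fun i j => \sum_(k \in [set: nat]) (M i k * N k j).

Definition infmx_tr M : nat -> nat -> F := fun i j => M j i.

(* M = diag(a, a, ...) with a an n x n block. *)
Definition n_periodic (n : nat) M : Prop :=
  exists a : 'M[F]_n,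
    (forall (q : nat) (i j : 'I_n), M (q * n + i)%N (q * n + j)%N = a i j) /\
    (forall i j : nat, (i %/ n <> j %/ n)%N -> M i j = 0).

Definition s_periodic (s : steinitz) : {pred nat -> nat -> F} :=
  [pred M | `[< exists n, nat_dvd_steinitz n s /\ n_periodic n M >]].

Fact n_periodicP n M : (0 < n)%N -> n_periodic n M <->
  forall i j, M i j = if (i %/ n == j %/ n)%N then M (i %% n)%N (j %% n)%N else 0.
Proof.
move=> n0; split=> [[a [Ma M0]] i j|HM].
  case: eqP => [eij|]; last exact: M0.
  have Hi := ltn_pmod i n0; have Hj := ltn_pmod j n0.
  have := Ma 0%N (Ordinal Hi) (Ordinal Hj); rewrite /= !mul0n !add0n => ->.
  by rewrite {1}(divn_eq i n) {1}(divn_eq j n) -eij (Ma _ (Ordinal Hi) (Ordinal Hj)).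
exists (\matrix_(i, j) M i j); split=> [q i j|i j /eqP/negPf ne]; last first.
  by rewrite HM ne.
by rewrite HM !divnMDl // !divn_small // eqxx !modnMDl !modn_small // mxE.
Qed.

Fact n_periodic_dvd m n M :
  (0 < n)%N -> (m %| n)%N -> n_periodic m M -> n_periodic n M.
Proof.
move=> n0 dvdmn; have m0 := dvdn_gt0 n0 dvdmn.
move=> /(n_periodicP _ m0) HM; apply/(n_periodicP _ n0) => i j.
have [k kE] := dvdnP dvdmn.
have divE x : (x %/ m = x %/ n * k + (x %% n) %/ m)%N.
  by rewrite {1}(divn_eq x n) {2}kE mulnA divnMDl.
rewrite HM [in RHS]HM !(modn_dvdm _ dvdmn).
case: (eqVneq (i %/ n)%N (j %/ n)%N) => [e|ne].
  by rewrite (divE i) (divE j) e eqn_add2l.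
case: eqP => // e; case/eqP: ne.
by rewrite kE mulnC !divnMA e.
Qed.

Fact s_periodic_common s M N : M \in s_periodic s -> N \in s_periodic s ->
  exists n, [/\ nat_dvd_steinitz n s, n_periodic n M & n_periodic n N].
Proof.
move=> /asboolP[m [ms Mm]] /asboolP[n [ns Nn]]; exists (lcmn m n).
have l0 : (0 < lcmn m n)%N by rewrite lcmn_gt0 ms.1 ns.1.
split; first exact: nat_dvd_steinitz_lcm.
  exact: n_periodic_dvd (dvdn_lcml m n) Mm.
exact: n_periodic_dvd (dvdn_lcmr m n) Nn.
Qed.

Fact n_periodic_band n M i k q : (0 < n)%N -> n_periodic n M ->
  (i < q * n)%N -> (q * n <= k)%N -> M i k = 0.
Proof.
move=> n0 [a [_ M0]] lti lek; apply: M0 => e.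
by move: lti; rewrite -ltn_divLR // e ltnNge leq_divRL // lek.
Qed.

Fact infmx_mulE n M N i j q : (0 < n)%N -> n_periodic n M -> (i < q * n)%N ->
  infmx_mul M N i j = \sum_(k < q * n) M i k * N k j.
Proof.
move=> n0 HM lti; rewrite /infmx_mul.
rewrite (fsbigE (index_iota 0 (q * n))) ?iota_uniq //; last first.
  move=> k _; rewrite mem_index_iota /= -leqNgt => lek.
  by rewrite (n_periodic_band n0 HM lti lek) mul0r.
by rewrite big_mkcond big_mkord; apply: eq_bigr => k _; rewrite in_setT.
Qed.

Fact n_periodic_mul n M N : (0 < n)%N -> n_periodic n M -> n_periodic n N ->
  n_periodic n (infmx_mul M N).
Proof.
move=> n0 HM HN; apply/(n_periodicP _ n0) => i j.
have lti x : (x < (x %/ n).+1 * n)%N by rewrite -ltn_divLR.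
rewrite (infmx_mulE _ _ n0 HM (lti i)).
have ltm : (i %% n < 1 * n)%N by rewrite mul1n ltn_pmod.
rewrite (infmx_mulE _ _ n0 HM ltm) mul1n.
move/(n_periodicP _ n0) in HM; move/(n_periodicP _ n0) in HN.
case: eqP => [e|ne]; last first.
  apply: big1 => k _; rewrite HM HN.
  case: eqP => [e1|_]; last by rewrite mul0r.
  by case: eqP => [e2|_]; [case: ne; rewrite e1 | rewrite mulr0].
rewrite mulSn addnC big_split_ord /= big1 ?add0r => [|k _]; last first.
  rewrite HM; case: eqP => [ek|_]; last by rewrite mul0r.
  by have := ltn_ord k; rewrite -ltn_divLR // -ek ltnn.
apply: eq_bigr => k _; have kn := ltn_ord k.
rewrite [M i _]HM [N _ j]HN !divnMDl // (divn_small kn) addn0 e !eqxx.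
by rewrite modnMDl (modn_small kn).
Qed.

Fact infmx_mulA n M N P : (0 < n)%N ->
  n_periodic n M -> n_periodic n N -> n_periodic n P ->
  infmx_mul M (infmx_mul N P) = infmx_mul (infmx_mul M N) P.
Proof.
move=> n0 HM HN HP; apply/funext => i; apply/funext => j.
set q := (i %/ n).+1; have lti : (i < q * n)%N by rewrite -ltn_divLR.
rewrite (infmx_mulE _ _ n0 HM lti).
rewrite (infmx_mulE _ _ n0 (n_periodic_mul n0 HM HN) lti).
under eq_bigr => k _ do rewrite (infmx_mulE _ _ n0 HN (ltn_ord k)) mulr_sumr.
rewrite exchange_big; apply: eq_bigr => l _ /=.
rewrite (infmx_mulE _ _ n0 HM lti) mulr_suml.
by apply: eq_bigr => k _; rewrite mulrA.
Qed.

End InfiniteMatrices.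

Section PeriodicMatrices.
Variables (F : fieldType) (s : steinitz).

Record periodic_mx := PeriodicMx {
  pmx : nat -> nat -> F;
  pmxP : pmx \in s_periodic (F := F) s
}.

HB.instance Definition _ := [isSub for pmx].
HB.instance Definition _ := [Choice of periodic_mx by <:].

Implicit Types (x y z : periodic_mx) (c : F).

Let pmx_inj x y : (forall i j, pmx x i j = pmx y i j) -> x = y.
Proof. by move=> e; apply/val_inj/funext => i; apply/funext => j; apply: e. Qed.

Let common2 x y : exists n,
  [/\ (0 < n)%N, n_periodic n (pmx x) & n_periodic n (pmx y)].
Proof.
by have [n [[n0 _] Hx Hy]] := s_periodic_common (pmxP x) (pmxP y); exists n.
Qed.

Let common3 x y z : exists n,
  [/\ (0 < n)%N, n_periodic n (pmx x), n_periodic n (pmx y)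
    & n_periodic n (pmx z)].
Proof.
have [m [m0 Hx Hy]] := common2 x y.
have [n [n0 Hn Hz]] := common2 x z.
exists (lcmn m n).
have l0 : (0 < lcmn m n)%N by rewrite lcmn_gt0 m0.
split=> //.
- exact: n_periodic_dvd (dvdn_lcml m n) Hx.
- exact: n_periodic_dvd (dvdn_lcml m n) Hy.
- exact: n_periodic_dvd (dvdn_lcmr m n) Hz.
Qed.

Fact pm_scalar_subproof c : (fun i j => c *+ (i == j)) \in s_periodic (F := F) s.
Proof.
apply/asboolP; exists 1%N; split; first exact: nat_dvd_steinitz1.
by apply/n_periodicP => // i j; rewrite !divn1 !modn1 eqxx; case: eqP.
Qed.
Definition pm_scalar c := PeriodicMx (pm_scalar_subproof c).

Fact pm_opp_subproof x : (fun i j => - pmx x i j) \in s_periodic (F := F) s.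
Proof.
case: x => M /= /asboolP[n [ns HM]]; apply/asboolP; exists n; split=> //.
move/(n_periodicP _ ns.1) in HM; apply/(n_periodicP _ ns.1) => i j.
by rewrite HM; case: eqP; rewrite ?oppr0.
Qed.
Definition pm_opp x := PeriodicMx (pm_opp_subproof x).

Fact pm_add_subproof x y : (fun i j => pmx x i j + pmx y i j) \in s_periodic (F := F) s.
Proof.
have [n [ns Hx Hy]] := s_periodic_common (pmxP x) (pmxP y).
apply/asboolP; exists n; split=> //; apply/(n_periodicP _ ns.1) => i j.
move/(n_periodicP _ ns.1) in Hx; move/(n_periodicP _ ns.1) in Hy.
by rewrite Hx Hy; case: eqP; rewrite ?addr0.
Qed.
Definition pm_add x y := PeriodicMx (pm_add_subproof x y).

Fact pm_scale_subproof c x : (fun i j => c * pmx x i j) \in s_periodic (F := F) s.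
Proof.
case: x => M /= /asboolP[n [ns HM]]; apply/asboolP; exists n; split=> //.
move/(n_periodicP _ ns.1) in HM; apply/(n_periodicP _ ns.1) => i j.
by rewrite HM; case: eqP; rewrite ?mulr0.
Qed.
Definition pm_scale c x := PeriodicMx (pm_scale_subproof c x).

Fact pm_mul_subproof x y : infmx_mul (pmx x) (pmx y) \in s_periodic (F := F) s.
Proof.
have [n [ns Hx Hy]] := s_periodic_common (pmxP x) (pmxP y).
by apply/asboolP; exists n; split=> //; apply: n_periodic_mul ns.1 Hx Hy.
Qed.
Definition pm_mul x y := PeriodicMx (pm_mul_subproof x y).

Fact pm_tr_subproof x : infmx_tr (pmx x) \in s_periodic (F := F) s.
Proof.
case: x => M /= /asboolP[n [ns HM]]; apply/asboolP; exists n; split=> //.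
move/(n_periodicP _ ns.1) in HM; apply/(n_periodicP _ ns.1) => i j.
by rewrite /infmx_tr HM eq_sym.
Qed.
Definition pm_tr x : periodic_mx := PeriodicMx (pm_tr_subproof x).

Fact pm_addA : associative pm_add.
Proof. by move=> x y z; apply: pmx_inj => i j; apply: addrA. Qed.
Fact pm_addC : commutative pm_add.
Proof. by move=> x y; apply: pmx_inj => i j; apply: addrC. Qed.
Fact pm_add0 : left_id (pm_scalar 0) pm_add.
Proof. by move=> x; apply: pmx_inj => i j /=; rewrite mul0rn add0r. Qed.
Fact pm_addN : left_inverse (pm_scalar 0) pm_opp pm_add.
Proof. by move=> x; apply: pmx_inj => i j /=; rewrite mul0rn addNr. Qed.

HB.instance Definition _ :=
  GRing.isZmodule.Build periodic_mx pm_addA pm_addC pm_add0 pm_addN.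

Fact pm_mulA : associative pm_mul.
Proof.
move=> x y z; have [n [n0 Hx Hy Hz]] := common3 x y z.
by apply: val_inj; apply: infmx_mulA n0 Hx Hy Hz.
Qed.

Let scalar_periodic n c : (0 < n)%N -> n_periodic n (pmx (pm_scalar c)).
Proof.
move=> n0; apply: (@n_periodic_dvd _ 1) => //.
by apply/n_periodicP => // i j /=; rewrite !divn1 !modn1 eqxx; case: eqP.
Qed.

Fact pm_scalar_mul c x : pm_mul (pm_scalar c) x = pm_scale c x.
Proof.
apply: pmx_inj => i j /=.
rewrite (@infmx_mulE _ 1 _ _ i j i.+1) ?muln1 //; last exact: scalar_periodic.
rewrite big_ord_recr /= eqxx mulr1n big1 ?add0r // => k _.
by rewrite gtn_eqF ?mulr0n ?mul0r.
Qed.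

Fact pm_mul_scalar c x : pm_mul x (pm_scalar c) = pm_scale c x.
Proof.
apply: pmx_inj => i j /=.
rewrite /infmx_mul (fsbigE [:: j]) //=.
  by rewrite big_mkcond big_seq1 in_setT eqxx mulr1n mulrC.
by move=> k _; rewrite inE => /negPf ->; rewrite mulr0n mulr0.
Qed.

Fact pm_scale1 x : pm_scale 1 x = x.
Proof. by apply: pmx_inj => i j; apply: mul1r. Qed.
Fact pm_mul1 : left_id (pm_scalar 1) pm_mul.
Proof. by move=> x; rewrite pm_scalar_mul pm_scale1. Qed.
Fact pm_mulr1 : right_id (pm_scalar 1) pm_mul.
Proof. by move=> x; rewrite pm_mul_scalar pm_scale1. Qed.

Fact pm_mulDl : left_distributive pm_mul +%R.
Proof.
move=> x y z; have [n [n0 Hx Hy Hz]] := common3 x y (x + y).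
apply: pmx_inj => i j; have lti : (i < (i %/ n).+1 * n)%N by rewrite -ltn_divLR.
rewrite /= (infmx_mulE _ _ n0 Hz lti) (infmx_mulE _ _ n0 Hx lti).
rewrite (infmx_mulE _ _ n0 Hy lti) -big_split /=.
by apply: eq_bigr => k _; rewrite mulrDl.
Qed.

Fact pm_mulDr : right_distributive pm_mul +%R.
Proof.
move=> x y z; have [n [n0 Hx _]] := common2 x x.
apply: pmx_inj => i j; have lti : (i < (i %/ n).+1 * n)%N by rewrite -ltn_divLR.
rewrite /= !(infmx_mulE _ _ n0 Hx lti) -big_split /=.
by apply: eq_bigr => k _; rewrite mulrDr.
Qed.

Fact pm_oner_neq0 : pm_scalar 1 != 0.
Proof.
apply/eqP => /(congr1 (fun x => pmx x 0%N 0%N)) /= /eqP.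
by rewrite mulr1n mul0rn oner_eq0.
Qed.

HB.instance Definition _ := GRing.Zmodule_isNzRing.Build periodic_mx
  pm_mulA pm_mul1 pm_mulr1 pm_mulDl pm_mulDr pm_oner_neq0.

Fact pm_scaleA b c x : pm_scale b (pm_scale c x) = pm_scale (b * c) x.
Proof. by apply: pmx_inj => i j; apply: mulrA. Qed.
Fact pm_scaleDr : right_distributive pm_scale +%R.
Proof. by move=> c x y; apply: pmx_inj => i j; apply: mulrDr. Qed.
Fact pm_scaleDl x : {morph pm_scale^~ x : b c / b + c}.
Proof. by move=> b c; apply: pmx_inj => i j; apply: mulrDl. Qed.

HB.instance Definition _ := GRing.Zmodule_isLmodule.Build F periodic_mx
  pm_scaleA pm_scale1 pm_scaleDr pm_scaleDl.

Fact pm_scaleAl c x y : c *: (x * y) = (c *: x) * y.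
Proof.
have e z : c *: z = pm_scalar c * z by rewrite -[RHS]/(pm_mul _ _) pm_scalar_mul.
by rewrite !e mulrA.
Qed.

HB.instance Definition _ :=
  GRing.Lmodule_isLalgebra.Build F periodic_mx pm_scaleAl.

Fact pm_scaleAr c x y : c *: (x * y) = x * (c *: y).
Proof.
have e z : c *: z = z * pm_scalar c by rewrite -[RHS]/(pm_mul _ _) pm_mul_scalar.
by rewrite !e mulrA.
Qed.

HB.instance Definition _ :=
  GRing.Lalgebra_isAlgebra.Build F periodic_mx pm_scaleAr.

End PeriodicMatrices.

Section LocallyMatrix.
Variables (F : fieldType) (A : unitAlgType F).

(* f is a unital F-algebra isomorphism of M_n(F) onto A'; it is an rmorphism
   that is scalable because 'M[F]_n has no lalgType instance for variable n. *)
Definition matrix_subalgebra (n : nat) (A' : {pred A}) : Prop :=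
  GRing.subalg_closed A' /\
  exists f : {rmorphism 'M[F]_n -> A},
    [/\ scalable f, injective f & forall x, x \in A' <-> exists m, x = f m].

Definition locally_matrix : Prop :=
  forall a : seq A, exists (n : nat) (A' : {pred A}),
    [/\ (0 < n)%N, matrix_subalgebra n A' & {subset a <= A'}].

Definition matrix_degrees : set nat :=
  [set n | (0 < n)%N /\ exists A' : {pred A}, matrix_subalgebra n A'].

Definition steinitz_number : steinitz := steinitz_lcm matrix_degrees.

End LocallyMatrix.

Section CountableDimension.
Variables (F : fieldType) (V : lmodType F).

Definition is_basis (I : eqType) (e : I -> V) : Prop :=
  (forall (r : seq I) (c : I -> F), uniq r ->
     \sum_(i <- r) c i *: e i = 0 -> {in r, forall i, c i = 0}) /\
  (forall v, exists (r : seq I) (c : I -> F), v = \sum_(i <- r) c i *: e i).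

Definition countable_dimensional : Prop :=
  exists (I : countType) (e : I -> V), is_basis e.

End CountableDimension.

(* Main.v *)
Require Import Defs.
From mathcomp Require Import all_boot all_order all_algebra.
From HB Require Import structures.
From mathcomp Require Import boolp fsbigop.
From Stdlib Require Ncring Ncring_tac.

(** For an idempotent e let U_e = 1 + eA(1-e), and let u = 1-2e. The group U_e is
    2-divisible, inverted by u and normalised by the centraliser of u. Conversely, a
    subgroup H inverted by u is abelian; if it is also normalised by C(u), then
    commuting h in H with its conjugates by elements of C(u) forces every h to be
    block triangular along e, so that the squares of H lie in U_e or in U_(1-e). Since
    involutions correspond to idempotents, an isomorphism phi of unit groups therefore
    matches each e with an idempotent f of B such that phi maps U_e onto U_f and
    U_(1-e) onto U_(1-f).

    For a system of n >= 3 matrix units the matched idempotents f_i, or all their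
    complements 1 - f_i, are pairwise orthogonal; composing phi with g |-> (g^-1)^t
    exchanges the two cases. In the orthogonal case the additive maps
    x |-> phi(1+x) - 1 between Peirce components are multiplicative by the commutator
    relations, and extend to a ring isomorphism theta. For n = 2 (where A = M_2(F)) the
    Weyl elements provide a Jordan homomorphism with commuting values on F instead, and
    for n = 1 both algebras equal F.

    Finally psi = theta^-1 phi fixes U_e and U_(1-e) pointwise, hence sends the big cell
    elements along e to scalar multiples of themselves. This applies to enough
    transvections 1 + x that the element g^-1 psi(g) must be central for every g. *)

Set Implicit Arguments.
Unset Strict Implicit.
Unset Printing Implicit Defensive.

Import GRing.Theory.
Local Open Scope ring_scope.

(** * Normalisation of noncommutative ring expressions *)

#[local] Instance nzRing_ops (R : nzRingType) :
  @Ncring.Ring_ops R 0 1 +%R *%R (fun x y => x - y) -%R eq := {}.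

#[local] Instance nzRing_Ring (R : nzRingType) :
  @Ncring.Ring R 0 1 +%R *%R (fun x y => x - y) -%R eq (nzRing_ops R).
Proof.
split; first exact: RelationClasses.eq_equivalence.
all: try by [move=> x y -> z t -> | move=> x y ->].
- exact: add0r.
- exact: addrC.
- exact: addrA.
- exact: mul1r.
- exact: mulr1.
- exact: mulrA.
- exact: mulrDl.
- by move=> x y z; apply: mulrDr.
- by [].
- exact: subrr.
Qed.

Ltac ncring := Ncring_tac.non_commutative_ring.

(** * Peirce components and reflections *)

Section Corner.
Variable R : nzRingType.
Implicit Types e f x y : R.

Definition idem e := e * e = e.

Lemma idemC e : idem e -> idem (1 - e).
Proof. by move=> He; rewrite /idem mulrBl mul1r mulrBr mulr1 He subrr subr0. Qed.

Lemma idem_mulC e : idem e -> e * (1 - e) = 0.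
Proof. by move=> He; rewrite mulrBr mulr1 He subrr. Qed.

Lemma idem_mulCl e : idem e -> (1 - e) * e = 0.
Proof. by move=> He; rewrite mulrBl mul1r He subrr. Qed.

Lemma subr1K e : 1 - (1 - e) = e.
Proof. by rewrite opprB addrC subrK. Qed.

Lemma add1K x : 1 + x - 1 = x.
Proof. by rewrite addrC addKr. Qed.

(* [corner e f] is the Peirce component eRf. *)
Definition corner e f x := e * x = x /\ x * f = x.

Lemma cornerM e f x : idem e -> idem f -> corner e f (e * x * f).
Proof. by move=> He Hf; split; rewrite ?mulrA ?He // -mulrA Hf. Qed.

Lemma cornerD e f x y : corner e f x -> corner e f y -> corner e f (x + y).
Proof. by case=> h1 h2 [h3 h4]; split; rewrite ?mulrDr ?mulrDl ?h1 ?h2 ?h3 ?h4. Qed.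

Lemma cornerN e f x : corner e f x -> corner e f (- x).
Proof. by case=> h1 h2; split; rewrite ?mulrN ?mulNr ?h1 ?h2. Qed.

Lemma corner_mul e f g h x y : corner e f x -> corner g h y -> corner e h (x * y).
Proof. by case=> h1 _ [_ h2]; split; rewrite ?mulrA ?h1 // -mulrA h2. Qed.

Lemma corner_mul0 e f f' g x y : f * f' = 0 ->
  corner e f x -> corner f' g y -> x * y = 0.
Proof. by move=> h [_ <-] [<- _]; rewrite mulrA -(mulrA x) h mulr0 mul0r. Qed.

(** The additive form of U_e; the opposite component (1-e)Re is [upper (1 - e)], once [1 - (1 - e)]
    is simplified. *)
Definition upper e := corner e (1 - e).

Lemma upperP e x : upper e x <-> e * x = x /\ x * e = 0.
Proof.
rewrite /upper /corner mulrBr mulr1; split=> -[h1 h2]; split=> //.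
  by apply: (@addrI _ (x - x * e)); rewrite subrK addr0 h2.
by rewrite h2 subr0.
Qed.

Lemma upperCP e x : upper (1 - e) x <-> e * x = 0 /\ x * e = x.
Proof.
rewrite /upper /corner subr1K mulrBl mul1r; split=> -[h1 h2]; split=> //.
  by apply: (@addrI _ (x - e * x)); rewrite subrK addr0 h1.
by rewrite h1 subr0.
Qed.

Lemma upper_mul0 e x y : idem e -> upper e x -> upper e y -> x * y = 0.
Proof. by move=> He; apply/corner_mul0/idem_mulCl. Qed.

Lemma upper_sqr e x : idem e -> upper e x -> x * x = 0.
Proof. by move=> He Hx; apply: (upper_mul0 He). Qed.

(** This puts an off-diagonal component in reach of two idempotents at once, its row idempotent and
    its column idempotent. *)
Lemma corner_upper e f x : e * f = 0 -> f * e = 0 ->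
  corner e f x -> upper e x /\ upper (1 - f) x.
Proof.
move=> h1 h2 [h3 h4]; rewrite upperP upperCP; do !split=> //.
  by rewrite -h4 -mulrA h2 mulr0.
by rewrite -h3 mulrA h2 mul0r.
Qed.

Definition refl e := 1 - (e + e).

Lemma reflC e : refl (1 - e) = - refl e.
Proof. rewrite /refl; ncring. Qed.

Lemma refl_sqr e : idem e -> refl e * refl e = 1.
Proof.
move=> He; have -> : refl e * refl e = 1 + (e * e - e) *+ 4.
  by rewrite /refl !mulrS mulr0n; ncring.
by rewrite He subrr mul0rn addr0.
Qed.

Lemma refl_comm e x : e * x = x * e -> refl e * x = x * refl e.
Proof. by move=> h; rewrite /refl mulrBl mulrBr mul1r mulr1 mulrDl mulrDr h. Qed.

Lemma refl_upper e x : upper e x -> refl e * x = - x /\ x * refl e = x.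
Proof.
move=> /upperP[h1 h2]; rewrite /refl mulrBl mulrBr mulrDl mulrDr h1 h2.
by split; ncring.
Qed.

Lemma sqr0_inv x : x * x = 0 -> (1 + x) * (1 - x) = 1 /\ (1 - x) * (1 + x) = 1.
Proof.
move=> h.
have -> : (1 + x) * (1 - x) = 1 - x * x by ncring.
have -> : (1 - x) * (1 + x) = 1 - x * x by ncring.
by rewrite h subr0.
Qed.

(** A block triangular h inverted by u = [refl e] has diagonal blocks of square one, because u
    commutes with the diagonal part. Hence h^2 has identity diagonal blocks. *)
Lemma upper_square_involution e h : idem e -> refl e * h * (refl e * h) = 1 ->
  (1 - e) * h * e = 0 -> upper e (h * h - 1).
Proof.
move=> He Hu Hc.
have he : h * e = e * h * e.
  by apply/eqP; rewrite -subr_eq0 -Hc; apply/eqP; ncring.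
have eh : (1 - e) * h = (1 - e) * h * (1 - e) by rewrite mulrBr mulr1 Hc subr0.
have ue : refl e * e = - e.
  by rewrite /refl mulrBl mul1r mulrDl He; ncring.
have eu : (1 - e) * refl e = 1 - e.
  by rewrite /refl mulrBr mulr1 mulrDr idem_mulCl //; ncring.
have uhe : refl e * (h * e) = - (h * e) by rewrite he !mulrA ue !mulNr.
have Hr : h * h * e = e.
  have : refl e * h * (refl e * h) * e = e by rewrite Hu mul1r.
  rewrite -!mulrA uhe !mulrN.
  by rewrite he -mulrA (mulrA h) he !mulrA ue !mulNr opprK.
have Hl : (1 - e) * (h * h) = 1 - e.
  have : (1 - e) * (refl e * h * (refl e * h)) = 1 - e by rewrite Hu mulr1.
  rewrite !mulrA eu [(1 - e) * h]eh -(mulrA _ (1 - e) (refl e)) eu.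
  by rewrite -eh.
apply/upperP; split; last by rewrite mulrBl mul1r Hr subrr.
have -> : e * (h * h - 1) = h * h - 1 - ((1 - e) * (h * h) - (1 - e)) by ncring.
by rewrite Hl subrr subr0.
Qed.

End Corner.

(** * Products with matrix units in M_n *)

Section MatrixUnits.
Variables (R : comNzRingType) (n : nat).
Implicit Types (m : 'M[R]_n) (i j k l : 'I_n).

Lemma mulmx_deltaE m i j k l : (m *m delta_mx i j) k l = m k i *+ (l == j).
Proof.
rewrite !mxE (bigD1 i) //= !mxE eqxx big1 ?addr0 ?mulr_natr // => a /negPf ne.
by rewrite !mxE ne mulr0.
Qed.

Lemma delta_mulmxE m i j k l : (delta_mx i j *m m) k l = m j l *+ (k == i).
Proof.
rewrite !mxE (bigD1 j) //= !mxE eqxx big1 ?addr0 ?andbT ?mulr_natl // => a /negPf ne.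
by rewrite !mxE ne andbF mul0r.
Qed.

Lemma delta_mulmx_delta m i j :
  delta_mx i j *m m *m delta_mx i j = m j i *: delta_mx i j.
Proof.
apply/matrixP => k l; rewrite mulmx_deltaE delta_mulmxE !mxE.
by case: (k == i); case: (l == j); rewrite /= ?mulr0 ?mulr1.
Qed.

End MatrixUnits.

(** * Rank-one elements, primeness and scalar centralisers *)

Section LocallyMatrixTheory.
Variables (F : fieldType) (A : unitAlgType F).
Hypothesis A_locmx : locally_matrix A.
Implicit Types (b c e h p q x y : A).

(** In a matrix subalgebra containing b, c and p, choose nonzero entries b_ki and c_jl and let x be
    the matrix unit E_ij. Then bxc has (k,l) entry b_ki c_jl, and xpx = p_ji x. *)
Lemma locally_matrix_rank1 b c p : b != 0 -> c != 0 ->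
  exists x (t : F), b * x * c != 0 /\ x * p * x = t *: x.
Proof.
move=> b0 c0; have [n [A' [n0 [_ [f [fZ fI fP]]] sub]]] := A_locmx [:: b; c; p].
have [mb Eb] : exists m, b = f m by apply/fP/sub; rewrite !inE eqxx.
have [mc Ec] : exists m, c = f m by apply/fP/sub; rewrite !inE eqxx orbT.
have [mp Ep] : exists m, p = f m by apply/fP/sub; rewrite !inE eqxx !orbT.
have mb0 : mb != 0 by apply: contraNneq b0 => m0; rewrite Eb m0 raddf0.
have mc0 : mc != 0 by apply: contraNneq c0 => m0; rewrite Ec m0 raddf0.
have /matrix0Pn[k [i bki]] := mb0; have /matrix0Pn[j [l cjl]] := mc0.
exists (f (delta_mx i j)), (mp j i); split.
  rewrite Eb Ec -!rmorphM; apply/eqP => /eqP; rewrite raddf_eq0 //.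
  move=> /eqP/matrixP/(_ k l)/eqP; rewrite -[_ * _ * _]mulmxA !mxE (bigD1 i) //=.
  rewrite delta_mulmxE eqxx big1 => [|a /negPf ne].
    by rewrite addr0 mulf_eq0 (negPf bki) (negPf cjl).
  by rewrite delta_mulmxE ne mulr0.
by rewrite Ep -!rmorphM -fZ [_ * _ * _]delta_mulmx_delta.
Qed.

(** In a matrix subalgebra containing h, p and q, every off-diagonal matrix unit satisfies the three
    conditions on x, and a matrix commuting with all of them is scalar. The freedom in p and q
    serves [fixing_scalar], where only such special x can be handled. *)
Lemma locally_matrix_scalar h p q :
  (forall x, x * x = 0 -> (exists t : F, x * p * x = t *: x) ->
     (exists t : F, x * q * x = t *: x) -> h * x = x * h) ->
  exists c : F, h = c%:A.
Proof.
move=> Hh; have [n [A' [n0 [_ [f [fZ fI fP]]] sub]]] := A_locmx [:: h; p; q].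
have [mh Eh] : exists m, h = f m by apply/fP/sub; rewrite !inE eqxx.
have [mp Ep] : exists m, p = f m by apply/fP/sub; rewrite !inE eqxx orbT.
have [mq Eq] : exists m, q = f m by apply/fP/sub; rewrite !inE eqxx !orbT.
have comm (i j : 'I_n) : i != j -> mh *m delta_mx i j = delta_mx i j *m mh.
  move=> ij; apply: fI; rewrite !rmorphM -Eh; apply: Hh.
  - by rewrite -rmorphM -[LHS]/(f (_ *m _)) mul_delta_mx_0 ?raddf0 // eq_sym.
  - by exists (mp j i); rewrite Ep -!rmorphM -fZ -delta_mulmx_delta.
  - by exists (mq j i); rewrite Eq -!rmorphM -fZ -delta_mulmx_delta.
case: n n0 f fZ fI fP mh mp mq Eh Ep Eq comm => // n _ f fZ fI fP mh _ _ Eh _ _ comm.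
exists (mh 0 0); rewrite Eh.
suff {1}-> : mh = mh 0 0 *: 1 by rewrite fZ rmorph1.
have cE i j k l : i != j -> (mh *m delta_mx i j) k l = (delta_mx i j *m mh) k l.
  by move=> /comm ->.
apply/matrixP => i j; rewrite !mxE; case: (eqVneq i j) => [<-|ij].
  rewrite mulr1; case: (eqVneq i 0) => [->//|i0].
  by have := cE i 0 i 0 i0; rewrite mulmx_deltaE delta_mulmxE !eqxx.
have ji : j != i by rewrite eq_sym.
by have := cE j i i i ji; rewrite mulr0n mulr0 mulmx_deltaE delta_mulmxE !eqxx (negPf ij).
Qed.

Lemma locally_matrix_prime b c : (forall x, b * x * c = 0) -> b = 0 \/ c = 0.
Proof.
move=> H; case: (eqVneq b 0) => [|b0]; first by left.
case: (eqVneq c 0) => [|c0]; first by right.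
by have [x [t [+ _]]] := locally_matrix_rank1 0 b0 c0; rewrite H eqxx.
Qed.

Lemma corner_neq0 e f : idem e -> idem f -> e <> 0 -> f <> 0 ->
  exists2 x, corner e f x & x <> 0.
Proof.
move=> He Hf /eqP e0 /eqP f0.
have [x [t [/eqP Hx _]]] := locally_matrix_rank1 0 e0 f0.
by exists (e * x * f) => //; apply: cornerM.
Qed.

Lemma sqr0_cent_scalar h : (forall x, x * x = 0 -> h * x = x * h) ->
  exists c : F, h = c%:A.
Proof. by move=> H; apply: (locally_matrix_scalar (p := 0) (q := 0)) => x /H. Qed.

(** Commuting with eA(1-e) and (1-e)Ae kills the off-diagonal blocks of h, by primeness. For x in
    eAe and z in eA(1-e), both z and xz commute with h, so hx - xh annihilates eA(1-e) from the left
    and vanishes by primeness; likewise for 1-e. Thus h is central. *)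
Lemma upper_cent_scalar e h : idem e -> e <> 0 -> 1 - e <> 0 ->
  (forall x, upper e x -> h * x = x * h) ->
  (forall x, upper (1 - e) x -> h * x = x * h) -> exists c : F, h = c%:A.
Proof.
move=> He e0 e1 Hup Hlow; have He' := idemC He.
have half g : idem g -> 1 - g <> 0 ->
    (forall x, upper g x -> h * x = x * h) -> (1 - g) * h * g = 0.
  move=> Hg g1 Hgx; have Hg' := idemC Hg.
  suff /locally_matrix_prime[] : forall x, (1 - g) * h * g * x * (1 - g) = 0 by [].
  move=> x; have Hx : upper g (g * x * (1 - g)) by apply: cornerM.
  transitivity ((1 - g) * (h * (g * x * (1 - g)))).
    by rewrite !mulrA -(mulrA (_ * h)).
  by rewrite (Hgx _ Hx) !mulrA idem_mulCl // !mul0r.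
have c0 := half _ He e1 Hup.
have b0 : e * h * (1 - e) = 0.
  by have := half _ He'; rewrite subr1K => /(_ e0 Hlow).
have eh : e * h = h * e.
  have -> : e * h = e * h * (1 - e) + h * e - (1 - e) * h * e by ncring.
  by rewrite b0 c0 add0r subr0.
have diag g x : idem g -> 1 - g <> 0 -> g * h = h * g ->
    (forall y, upper g y -> h * y = y * h) -> corner g g x -> h * x = x * h.
  move=> Hg g1 gh Hgy [gx xg]; have Hg' := idemC Hg.
  suff /locally_matrix_prime[/eqP|//] : forall y, (h * x - x * h) * y * (1 - g) = 0.
    by rewrite subr_eq0 => /eqP.
  move=> y; have Hy : upper g (g * y * (1 - g)) by apply: cornerM.
  have Hxy : upper g (x * (g * y * (1 - g))).
    by apply: (@corner_mul _ g g g) => //; case: Hy.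
  have -> : (h * x - x * h) * y * (1 - g) =
      h * (x * (g * y * (1 - g))) - x * (h * (g * y * (1 - g))).
    rewrite mulrBl mulrBl; congr (_ - _); first by rewrite !mulrA -(mulrA h x) xg.
    by rewrite !mulrA -(mulrA x h) -gh !mulrA xg.
  by rewrite (Hgy _ Hxy) (Hgy _ Hy) !mulrA subrr.
have Hh x : h * x = x * h.
  have -> : x = e * x * e + e * x * (1 - e) + (1 - e) * x * e
                + (1 - e) * x * (1 - e) by ncring.
  have he : (1 - e) * h = h * (1 - e) by rewrite mulrBl mulrBr mul1r mulr1 eh.
  have := diag _ _ He e1 eh Hup (cornerM x He He).
  have := Hup _ (cornerM x He He').
  have : h * ((1 - e) * x * e) = (1 - e) * x * e * h.
    by apply: Hlow; rewrite /upper subr1K; apply: cornerM.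
  have : h * ((1 - e) * x * (1 - e)) = (1 - e) * x * (1 - e) * h.
    by apply: (diag (1 - e)); rewrite ?subr1K //; apply: cornerM.
  move: (e * x * e) (e * x * (1 - e)) (_ * e) (_ * (1 - e)) => a b c d.
  by rewrite !mulrDr !mulrDl => -> -> -> ->.
by apply: sqr0_cent_scalar => x _.
Qed.

End LocallyMatrixTheory.

(** * Subgroups inverted by a reflection *)

Section InvertedSubgroups.
Variables (F : fieldType) (A : unitAlgType F).
Hypothesis A_locmx : locally_matrix A.
Hypotheses (F2 : 2%:R != 0 :> F) (F3 : 3%:R != 0 :> F).
Implicit Types (b c e h k p q x y : A).

Lemma unit_sqr0 x : x * x = 0 -> 1 + x \is a GRing.unit /\ (1 + x)^-1 = 1 - x.
Proof.
case/sqr0_inv => h1 h2.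
have U : 1 + x \is a GRing.unit by apply/unitrP; exists (1 - x).
by split=> //; apply: (mulrI U); rewrite h1 mulrV.
Qed.

Lemma unit_add_rank1 x (t : F) : x * x = t *: x -> 1 + t != 0 ->
  1 + x \is a GRing.unit.
Proof.
move=> xx t1; apply/unitrP; set y := (1 + t)^-1 *: x; exists (1 - y).
have H : x - y - y * x = 0.
  rewrite -scalerAl xx scalerA -{1}(scale1r x) -!scalerBl -addrA -opprD.
  by rewrite -{1}[_^-1]mulr1 -mulrDr mulVf // subrr scale0r.
have xy : x * y = y * x by rewrite -scalerAl -scalerAr.
have -> : (1 - y) * (1 + x) = 1 + (x - y - y * x) by ncring.
have -> : (1 + x) * (1 - y) = 1 + (x - y - x * y) by ncring.
by rewrite xy H addr0.
Qed.

Section Stable.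
Variables (e : A) (S : A -> Prop).
Hypothesis e_idem : idem e.
Hypothesis S_mul : forall h k, S h -> S k -> S (h * k).
Hypothesis S_inv : forall h, S h -> refl e * h * (refl e * h) = 1.
Hypothesis S_conj : forall h d, d \is a GRing.unit -> d * e = e * d -> S h ->
  S (d * h * d^-1).

Let u2 : refl e * refl e = 1 := refl_sqr e_idem.

Lemma stable_inv h : S h -> h * (refl e * h * refl e) = 1.
Proof.
move=> /S_inv Hh; have -> : h * (refl e * h * refl e) =
  refl e * refl e * h * (refl e * h * refl e) by rewrite u2 mul1r.
have -> : refl e * refl e * h * (refl e * h * refl e) =
  refl e * (refl e * h * (refl e * h)) * refl e by ncring.
by rewrite Hh mulr1.
Qed.

(** Conjugation by [refl e] is a homomorphism that inverts S, and inversion is multiplicative only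
    on commuting elements. *)
Lemma stable_comm h k : S h -> S k -> h * k = k * h.
Proof.
move=> Sh Sk; have hV := stable_inv Sh; have kV := stable_inv Sk.
have E : refl e * h * refl e * (refl e * k * refl e) * (h * k) = 1.
  by rewrite -(S_inv (S_mul Sh Sk)) !mulrA -(mulrA _ (refl e) (refl e)) u2 mulr1.
have : k * h * (refl e * h * refl e * (refl e * k * refl e) * (h * k)) = k * h.
  by rewrite E mulr1.
have -> : k * h * (refl e * h * refl e * (refl e * k * refl e) * (h * k)) =
  k * (h * (refl e * h * refl e)) * (refl e * k * refl e) * (h * k) by ncring.
by rewrite hV mulr1 kV mul1r.
Qed.

(** Put X = ehqhe and Y = ehehe. Compressing by e the commutation of h with its conjugate by q shows
    that X does not change when q is replaced by q^-1. The conjugate by dq, with d = 1+e, gives the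
    further relation X + Y = 4X - 2Y. Hence 3(X - Y) = 0, and this is where characteristic 3 is
    excluded. *)
Lemma stable_corner_twist h q : S h -> q \is a GRing.unit ->
  e * q = e -> q * e = e -> e * h * q * h * e = e * h * e * h * e.
Proof.
move=> Sh Uq eq qe.
have qVe : q^-1 * e = e by rewrite -{1}qe mulKr.
have eqV : e * q^-1 = e by rewrite -{1}eq mulrK.
set k := q * h * q^-1.
have Sk : S k by apply: S_conj; rewrite ?eq ?qe.
have E1 : e * h * q * h * e = e * h * q^-1 * h * e.
  have : e * (h * k) * e = e * (k * h) * e by rewrite (stable_comm Sh Sk).
  rewrite /k !mulrA eq -(mulrA _ q^-1 e) qVe => ->.
  by [].
pose d := 1 + e.
(* d acts as 2 on eA and as the identity on (1-e)A, so the paths through e and through 1-e are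
   weighted differently. *)
have Ud : d \is a GRing.unit by apply: (@unit_add_rank1 _ 1); rewrite ?scale1r.
have de : d * e = e + e by rewrite mulrDl mul1r e_idem.
have ed : e * d = e + e by rewrite mulrDr mulr1 e_idem.
have dVe : e * d^-1 = d^-1 * e.
  by apply: (mulrI Ud); apply: (mulIr Ud); rewrite mulVKr // -!mulrA mulVr // mulr1 de ed.
have dV : d^-1 = 1 - e * d^-1.
  by apply: (mulIr Ud); rewrite mulrBl -mulrA mulVr // mulr1 mul1r addrK.
have Sk2 : S (d * k * d^-1).
  by apply: S_conj => //; rewrite de ed.
have E2 : e * (h * (d * k * d^-1)) * e = e * (d * k * d^-1 * h) * e.
  by rewrite (stable_comm Sh Sk2).
have L : e * (h * (d * k * d^-1)) * e * d = e * h * q * h * e + e * h * e * h * e.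
  transitivity (e * h * d * (q * h * (q^-1 * (e * d^-1) * d))).
    by rewrite dVe /k !mulrA.
  by rewrite -!mulrA mulVr // mulr1 qVe /d mulrDl mul1r !mulrDr !mulrA -(mulrA _ e q) eq.
have H2 : e * d^-1 + e * d^-1 = e by rewrite -mulrDl -ed mulrK.
have R : e * (d * k * d^-1 * h) * e * d =
    (e * h * q^-1 * h * e) *+ 4 - (e * h * e * h * e) *+ 2.
  transitivity ((e * d) * q * (h * (q^-1 * d^-1) * h * (e * d))).
    by rewrite /k !mulrA.
  have -> : q^-1 * d^-1 = q^-1 - e * d^-1.
    by rewrite {1}dV mulrBr mulr1 dVe; congr (_ - _); rewrite -dVe mulrA qVe.
  have -> : e * h * e * h * e = e * h * (e * d^-1 + e * d^-1) * h * e by rewrite H2.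
  by rewrite ed mulrDl eq !mulrS !mulr0n; ncring.
move: L; rewrite E2 R -E1.
set X := e * h * q * h * e; set Y := e * h * e * h * e => XY.
have : (3%:R : F) *: (X - Y) = 0.
  rewrite scaler_nat; have -> : (X - Y) *+ 3 = X *+ 4 - Y *+ 2 - (X + Y).
    by rewrite !mulrS !mulr0n; ncring.
  by rewrite XY subrr.
by move/eqP; rewrite scaler_eq0 (negPf F3) subr_eq0 => /eqP.
Qed.

(** Let b and c be the off-diagonal blocks of h. Comparing [stable_corner_twist] at 1+y and at 1
    gives byc = 0 whenever y lies in (1-e)A(1-e) and 1+y is a unit. If b and c were both nonzero, a
    rank-one x in that corner would have bxc nonzero. *)
Lemma stable_triangular h : S h -> e * h * (1 - e) = 0 \/ (1 - e) * h * e = 0.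
Proof.
move=> Sh; case: (eqVneq (e * h * (1 - e)) 0) => [|b0]; first by left.
case: (eqVneq ((1 - e) * h * e) 0) => [|c0]; first by right.
have [x0 [t [/eqP bxc xex]]] := locally_matrix_rank1 A_locmx (1 - e) b0 c0.
have e'_idem := idemC e_idem.
set x := (1 - e) * x0 * (1 - e).
have ex : e * x = 0 by rewrite /x !mulrA idem_mulC // !mul0r.
have xe : x * e = 0 by rewrite /x -!mulrA idem_mulCl // !mulr0.
have xx : x * x = t *: x.
  rewrite /x scalerAl scalerAr -xex.
  have -> : (1 - e) * x0 * (1 - e) * ((1 - e) * x0 * (1 - e)) =
    (1 - e) * (x0 * ((1 - e) * (1 - e)) * x0) * (1 - e) by ncring.
  by rewrite e'_idem.
have kill (y : A) (t' : F) : e * y = 0 -> y * e = 0 -> y * y = t' *: y ->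
    1 + t' != 0 -> e * h * y * h * e = 0.
  move=> ey ye yy Ht.
  have U := unit_add_rank1 yy Ht.
  have := stable_corner_twist Sh U; rewrite mulrDr mulrDl ey ye !addr0.
  rewrite mulr1 mul1r => /(_ erefl erefl).
  have := stable_corner_twist Sh (unitr1 A); rewrite mulr1 mul1r => /(_ erefl erefl) E.
  rewrite -E mulrDr !mulrDl !mulr1 => H.
  by apply: (addrI (e * h * h * e)); rewrite H addr0.
case: bxc; have -> : e * h * (1 - e) * x0 * ((1 - e) * h * e) = e * h * x * h * e.
  by rewrite /x !mulrA.
(* One of 1+x and 1-x is a unit: if t = -1, then 1-t = 2 is nonzero. *)
case: (eqVneq (1 + t) 0) => [t1|]; last exact: kill xx.
have: e * h * (- x) * h * e = 0.
  apply: (@kill _ (- t)); rewrite ?mulrN ?mulNr ?ex ?xe ?oppr0 //.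
    by rewrite xx scalerN scaleNr !opprK.
  by apply: contra_neq F2 => t2; rewrite -[2%:R]/(1 + 1) -{1}(addrK t 1) t1 sub0r addrC.
by rewrite mulrN !mulNr => /eqP; rewrite oppr_eq0 => /eqP.
Qed.

(** The upper and the lower triangular elements cover S, and one kind suffices because a group is
    not the union of two proper subgroups. If h is not lower and k is not upper triangular, then hk
    is triangular of one kind; cancelling k or h, by means of the identity diagonal blocks of k^2
    and h^2, gives a contradiction. *)
Lemma stable_upper : (forall h, S h -> upper e (h * h - 1)) \/
  (forall h, S h -> upper (1 - e) (h * h - 1)).
Proof.
have e'_idem := idemC e_idem.
have Hup h : S h -> (1 - e) * h * e = 0 -> upper e (h * h - 1).
  by move=> Sh; apply: upper_square_involution => //; apply: S_inv.
have Hlow h : S h -> e * h * (1 - e) = 0 -> upper (1 - e) (h * h - 1).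
  move=> Sh Hb; apply: upper_square_involution; rewrite ?subr1K // reflC.
  by rewrite !mulNr mulrN opprK S_inv.
case: (pselect (exists2 h, S h & e * h * (1 - e) <> 0)) => [[h Sh hb]|no]; last first.
  by right=> h Sh; apply: Hlow => //; apply: contrapT => hb; apply: no; exists h.
have hc : (1 - e) * h * e = 0 by case: (stable_triangular Sh).
left=> k Sk; apply: (Hup) => //; case: (stable_triangular Sk) => // kb.
have /upperP[Hh _] := Hup h Sh hc.
have /upperCP[_ Hk] := Hlow k Sk kb.
have ke : (1 - e) * k * (1 - e) = k * (1 - e).
  by rewrite mulrBl mul1r mulrBl kb subr0.
have he : (1 - e) * h * (1 - e) = (1 - e) * h by rewrite mulrBr mulr1 hc subr0.
case: (stable_triangular (S_mul Sh Sk)) => E.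
  case: hb; have -> : e * h * (1 - e) = e * (h * k) * (1 - e) * k * (1 - e)
      - e * h * k * ((1 - e) * k * (1 - e) - k * (1 - e))
      - e * h * (k * k - 1 - (k * k - 1) * e) by ncring.
  by rewrite E ke Hk !subrr !mulr0 !mul0r !subr0.
have -> : (1 - e) * k * e = (1 - e) * h * ((1 - e) * (h * k) * e)
    - ((1 - e) * h * (1 - e) - (1 - e) * h) * h * k * e
    - (h * h - 1 - e * (h * h - 1)) * k * e by ncring.
by rewrite E he Hh !subrr !mulr0 !mul0r !subr0.
Qed.

End Stable.
End InvertedSubgroups.

(** * Matching idempotents *)

Section HalvedAlgebra.
Variables (F : fieldType) (A : unitAlgType F).
Hypothesis F2 : 2%:R != 0 :> F.
Implicit Types (e f x v : A).

Lemma halfD x : 2%:R^-1 *: x + 2%:R^-1 *: x = x.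
Proof. by rewrite -scalerDr -mulr2n -scaler_nat scalerA mulVf // scale1r. Qed.

Lemma addrr_inj x y : x + x = y + y -> x = y.
Proof. by rewrite -!mulr2n -!scaler_nat => /(scalerI F2). Qed.

Lemma refl_inj e f : refl e = refl f -> e = f.
Proof. by move/subrI/addrr_inj. Qed.

Lemma comm_refl e x : refl e * x = x * refl e -> e * x = x * e.
Proof.
rewrite /refl mulrBl mulrBr mul1r mulr1 mulrDl mulrDr.
by move/subrI/addrr_inj.
Qed.

Lemma involution_idem v : v * v = 1 -> exists2 f, idem f & refl f = v.
Proof.
move=> vv; exists (2%:R^-1 *: (1 - v)); last by rewrite /refl halfD subr1K.
rewrite /idem -scalerAl -scalerAr; congr (_ *: _).
have -> : (1 - v) * (1 - v) = (1 - v) + (1 - v) + (v * v - 1) by ncring.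
by rewrite vv subrr addr0 scalerDr halfD.
Qed.

Lemma cornerZ (c : F) e f x : corner e f x -> corner e f (c *: x).
Proof. by case=> h1 h2; split; rewrite -?scalerAl -?scalerAr ?h1 ?h2. Qed.

Lemma unit_involution v : v * v = 1 -> v \is a GRing.unit.
Proof. by move=> vv; apply/unitrP; exists v. Qed.

Lemma unit_upper e x : idem e -> upper e x -> 1 + x \is a GRing.unit.
Proof. by move=> He Hx; case: (unit_sqr0 (upper_sqr He Hx)). Qed.

End HalvedAlgebra.

(* phi and psi are total, but only their values on units matter. *)
Record unit_iso (A B : unitRingType) (phi : A -> B) (psi : B -> A) : Prop :=
  UnitIso {
    ui_unit : forall x, x \is a GRing.unit -> phi x \is a GRing.unit;
    ui_unitV : forall y, y \is a GRing.unit -> psi y \is a GRing.unit;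
    uiM : forall x y, x \is a GRing.unit -> y \is a GRing.unit ->
      phi (x * y) = phi x * phi y;
    uiK : forall x, x \is a GRing.unit -> psi (phi x) = x;
    uiVK : forall y, y \is a GRing.unit -> phi (psi y) = y }.

Lemma unit_iso_sym (A B : unitRingType) (phi : A -> B) (psi : B -> A) :
  unit_iso phi psi -> unit_iso psi phi.
Proof.
case=> U UV M K VK; split=> // x y Ux Uy.
by rewrite -{1}(VK x) // -{1}(VK y) // -M ?UV // K // unitrMl ?UV.
Qed.

Section UnitIsoTheory.
Variables (A B : unitRingType) (phi : A -> B) (psi : B -> A).
Hypothesis ui : unit_iso phi psi.

Lemma ui_inj x y : x \is a GRing.unit -> y \is a GRing.unit ->
  phi x = phi y -> x = y.
Proof. by move=> Ux Uy E; rewrite -(uiK ui Ux) E uiK. Qed.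

Lemma ui1 : phi 1 = 1.
Proof.
have U := ui_unit ui (unitr1 A); apply: (mulrI U).
by rewrite -(uiM ui) ?unitr1 // !mulr1.
Qed.

Lemma uiV x : x \is a GRing.unit -> phi x^-1 = (phi x)^-1.
Proof.
move=> Ux; have U := ui_unit ui Ux; apply: (mulrI U).
by rewrite -(uiM ui) ?unitrV // !mulrV ?ui1.
Qed.

End UnitIsoTheory.

Section Matching.
Variables (F : fieldType) (A B : unitAlgType F).
Hypotheses (A_locmx : locally_matrix A) (B_locmx : locally_matrix B).
Hypotheses (F2 : 2%:R != 0 :> F) (F3 : 3%:R != 0 :> F).
Variables (phi : A -> B) (psi : B -> A).
Hypothesis ui : unit_iso phi psi.

(** The image of -1 commutes with all units, in particular with 1+y for y^2 = 0, so it is a scalar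
    of square one. Injectivity excludes 1, since 2 is nonzero. *)
Lemma uiN1 : phi (-1) = -1.
Proof.
have U1 : (-1 : A) \is a GRing.unit by rewrite unitrN1.
have [y yy|c Ec] := @sqr0_cent_scalar _ _ B_locmx (phi (-1)).
  have [Uy _] := unit_sqr0 yy.
  have : phi (-1) * (1 + y) = (1 + y) * phi (-1).
    by rewrite -(uiVK ui Uy) -!(uiM ui) ?ui_unitV ?(ui_unitV ui) // mulrN1 mulN1r.
  by rewrite mulrDl mulrDr mulr1 mul1r => /addrI.
have cc : c ^+ 2 = 1.
  apply: (fmorph_inj (in_alg B)); rewrite rmorph1 rmorphXn /= -Ec expr2.
  by rewrite -(uiM ui) // mulrNN mulr1 (ui1 ui).
move/eqP: cc; rewrite -subr_eq0 subr_sqr_1 mulf_eq0 subr_eq0 addr_eq0.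
case/orP=> /eqP E; last by rewrite Ec E scaleN1r.
have /(ui_inj ui U1 (unitr1 _)) /eqP : phi (-1) = phi 1.
  by rewrite Ec E scale1r (ui1 ui).
rewrite eq_sym -subr_eq0 opprK -mulr2n -scaler_nat scaler_eq0 (negPf F2).
by rewrite oner_eq0.
Qed.

Lemma uiN x : x \is a GRing.unit -> phi (- x) = - phi x.
Proof. by move=> Ux; rewrite -mulN1r (uiM ui) ?unitrN1 // uiN1 mulN1r. Qed.

Lemma ui_upper e : idem e -> exists2 f, idem f & refl f = phi (refl e) /\
  ((forall x, upper e x -> upper f (phi (1 + x) - 1)) \/
   (forall x, upper e x -> upper (1 - f) (phi (1 + x) - 1))).
Proof.
move=> He; have ee := refl_sqr He; have Ue := unit_involution ee.
have [f Hf Ef] : exists2 f, idem f & refl f = phi (refl e).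
  by apply: involution_idem => //; rewrite -(uiM ui) // ee (ui1 ui).
exists f => //; split=> //.
have Ux x : upper e x -> 1 + x \is a GRing.unit by apply: unit_upper.
(* S is the image of U_e, to which the results on subgroups inverted by [refl f] are applied. *)
pose S y := exists2 x, upper e x & y = phi (1 + x).
have S_mul h k : S h -> S k -> S (h * k).
  move=> [x Hx ->] [y Hy ->]; exists (x + y); first exact: cornerD.
  rewrite -(uiM ui) ?Ux //; congr phi.
  have -> : (1 + x) * (1 + y) = 1 + (x + y) + x * y by ncring.
  by rewrite (upper_mul0 He) // addr0.
have S_inv h : S h -> refl f * h * (refl f * h) = 1.
  move=> [x Hx ->]; have Uxx := Ux x Hx.
  rewrite Ef -(uiM ui) // -(uiM ui) ?unitrMl //.
  rewrite -[RHS](ui1 ui).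
  have [h1 h2] := refl_upper Hx; rewrite mulrDr mulr1 h1; congr phi.
  have -> : (refl e - x) * (refl e - x) =
    refl e * refl e - refl e * x - x * refl e + x * x by ncring.
  by rewrite h1 h2 ee (upper_sqr He) // opprK addrK addr0.
have S_conj h d : d \is a GRing.unit -> d * f = f * d -> S h -> S (d * h * d^-1).
  move=> Ud df [x Hx ->]; have Ug := ui_unitV ui Ud.
  have ge : e * psi d = psi d * e.
    apply: (comm_refl F2); apply: (ui_inj ui); rewrite ?unitrMl //.
    by rewrite !(uiM ui) // -Ef (uiVK ui) //; apply: refl_comm.
  have /upperP[ex xe] := Hx.
  exists (psi d * x * (psi d)^-1).
    apply/upperP; rewrite !mulrA ge -(mulrA _ e) ex; split=> //.
    have -> : psi d * x * (psi d)^-1 * e = psi d * x * e * (psi d)^-1.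
      rewrite -!mulrA; congr (_ * (_ * _)).
      by apply: (mulrI Ug); apply: (mulIr Ug); rewrite mulVKr // -!mulrA mulVr // mulr1 ge.
    by rewrite -(mulrA _ x) xe mulr0 mul0r.
  rewrite -{1}(uiVK ui Ud) -{2}(uiVK ui Ud) -(uiV ui) //.
  rewrite -!(uiM ui) ?unitrMl ?unitrV ?Ux //; congr phi.
  by rewrite mulrDr mulr1 mulrDl mulrV.
(* Since 1+x = (1+x/2)^2, every element of S is a square of one, and [stable_upper] speaks of
   squares. *)
have sq x : upper e x -> exists2 h, S h & phi (1 + x) = h * h.
  move=> Hx; have Hx2 := cornerZ 2%:R^-1 Hx; exists (phi (1 + 2%:R^-1 *: x)).
    by exists (2%:R^-1 *: x).
  rewrite -(uiM ui) ?Ux //; congr phi.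
  set y := _ *: x; have -> : (1 + y) * (1 + y) = 1 + (y + y) + y * y by ncring.
  by rewrite (upper_mul0 He) // addr0 halfD.
have [H|H] := stable_upper B_locmx F2 F3 Hf S_mul S_inv S_conj; [left|right];
  by move=> x /sq[h Sh ->]; apply: H.
Qed.

End Matching.

(** The sign in [m_refl] leaves the choice between f and 1-f open, as [refl (1 - f)] is [- refl f];
    the other fields then settle it. *)
Record matched (A B : unitRingType) (phi : A -> B) (psi : B -> A) (e : A) (f : B) : Prop :=
  Matched {
    m_idem : idem e;
    m_idemV : idem f;
    m_refl : refl f = phi (refl e) \/ refl f = - phi (refl e);
    m_upper : forall x, upper e x -> upper f (phi (1 + x) - 1);
    m_lower : forall x, upper (1 - e) x -> upper (1 - f) (phi (1 + x) - 1);
    m_upperV : forall y, upper f y -> upper e (psi (1 + y) - 1);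
    m_lowerV : forall y, upper (1 - f) y -> upper (1 - e) (psi (1 + y) - 1) }.

Section Matched.
Variables (F : fieldType) (A B : unitAlgType F).
Hypotheses (A_locmx : locally_matrix A) (B_locmx : locally_matrix B).
Hypotheses (F2 : 2%:R != 0 :> F) (F3 : 3%:R != 0 :> F).

Implicit Types (phi : A -> B) (psi : B -> A).

Lemma refl_signed (R : unitAlgType F) (e e' : R) (v : R) : 
  (refl e = v \/ refl e = - v) -> (refl e' = v \/ refl e' = - v) ->
  e' = e \/ e' = 1 - e.
Proof.
move=> h1 h2; suff : refl e' = refl e \/ refl e' = refl (1 - e).
  by case=> /(refl_inj F2); [left | right].
by rewrite reflC; case: h1 => ->; case: h2 => ->; rewrite ?opprK; by [left|right].
Qed.

Lemma upper_neq0 e : idem e -> e <> 0 -> 1 - e <> 0 -> exists2 x : A, upper e x & x <> 0.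
Proof. by move=> He; apply: (corner_neq0 A_locmx) (idemC He). Qed.

(** By [ui_upper] for psi, the image of U_f lies in U_e or in U_(1-e). The second case fails at
    phi(1+x) for a nonzero x in eA(1-e), since psi returns 1+x. *)
Lemma ui_upper_back phi psi (e : A) (f : B) : unit_iso phi psi -> idem e -> idem f ->
  e <> 0 -> 1 - e <> 0 -> (refl f = phi (refl e) \/ refl f = - phi (refl e)) ->
  (forall x, upper e x -> upper f (phi (1 + x) - 1)) ->
  forall y, upper f y -> upper e (psi (1 + y) - 1).
Proof.
move=> ui He Hf e0 e1 Er Hup.
have Ue := unit_involution (refl_sqr He).
have [e' He' [Ee' Hback]] := ui_upper A_locmx F2 F3 (unit_iso_sym ui) Hf.
have Er' : psi (refl f) = refl e \/ psi (refl f) = - refl e.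
  case: Er => ->; first by left; rewrite (uiK ui).
  by right; rewrite (uiN A_locmx F2 (unit_iso_sym ui)) ?(ui_unit ui) // (uiK ui).
have Dh : (forall y, upper f y -> upper e (psi (1 + y) - 1)) \/
  (forall y, upper f y -> upper (1 - e) (psi (1 + y) - 1)).
  have [] : e' = e \/ e' = 1 - e.
    by apply: (@refl_signed _ _ _ (refl e)); [left | rewrite Ee'].
  - by move=> E; move: Hback; rewrite E.
  - by move=> E; move: Hback; rewrite E subr1K; case; [right|left].
case: Dh => // Hback'; have [x Hx x0] := upper_neq0 He e0 e1.
have := Hback' _ (Hup x Hx); rewrite subrKC (uiK ui) ?(unit_upper He) //.
rewrite add1K => /upperCP[ex _]; case: x0.
by case/upperP: Hx; rewrite ex.
Qed.

Lemma matchedC phi psi (e : A) (f : B) : unit_iso phi psi ->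
  matched phi psi e f -> matched phi psi (1 - e) (1 - f).
Proof.
move=> ui [He Hf Er H1 H2 H3 H4]; split; rewrite ?subr1K //; try exact: idemC.
rewrite !reflC (uiN B_locmx F2 ui) ?(unit_involution (refl_sqr _)) //.
by rewrite opprK; case: Er => ->; [left|right]; rewrite ?opprK.
Qed.

Lemma matched_ex phi psi (e : A) : unit_iso phi psi -> idem e ->
  e <> 0 -> 1 - e <> 0 -> exists f, matched phi psi e f.
Proof.
move=> ui He e0 e1; have He' := idemC He.
have Ue := unit_involution (refl_sqr He).
have [f Hf [Er Hup]] : exists2 f, idem f &
    (refl f = phi (refl e) \/ refl f = - phi (refl e)) /\
    (forall x, upper e x -> upper f (phi (1 + x) - 1)).
  have [f Hf [Ef [H|H]]] := ui_upper B_locmx F2 F3 ui He.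
    by exists f => //; split=> //; left.
  by exists (1 - f); [exact: idemC | split=> //; right; rewrite reflC Ef].
have Erl : refl (1 - f) = phi (refl (1 - e)) \/ refl (1 - f) = - phi (refl (1 - e)).
  rewrite !reflC (uiN B_locmx F2 ui) // opprK.
  by case: Er => ->; [left|right]; rewrite ?opprK.
have Hlow : forall x, upper (1 - e) x -> upper (1 - f) (phi (1 + x) - 1).
  have [g Eg Hg] : exists2 g, (g = f \/ g = 1 - f) &
      forall x, upper (1 - e) x -> upper g (phi (1 + x) - 1).
    have [g Hg [Eg H]] := ui_upper B_locmx F2 F3 ui He'.
    have gE : g = f \/ g = 1 - f.
      by apply: (refl_signed Er); right; rewrite Eg reflC (uiN B_locmx F2 ui).
    case: H => H; [exists g | exists (1 - g)] => //.
    by case: gE => ->; rewrite ?subr1K; [right|left].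
  case: Eg => Eg; last by rewrite -Eg.
  (* Here both U_e and U_(1-e) land in the abelian group U_f, so every x in eA(1-e) commutes with
     every z in (1-e)Ae. Then xz = exz = ezx = 0, which primeness forbids for nonzero x. *)
  have [x Hx x0] := upper_neq0 He e0 e1.
  suff : x = 0 \/ e = 0 by case.
  apply: (locally_matrix_prime A_locmx) => y.
  have Hy : upper (1 - e) ((1 - e) * y * e) by rewrite /upper subr1K; apply: cornerM.
  set z := (1 - e) * y * e in Hy.
  have Ux := unit_upper He Hx; have Uz := unit_upper He' Hy.
  have xz : x * z = z * x.
    have : (1 + x) * (1 + z) = (1 + z) * (1 + x).
      apply: (ui_inj ui); rewrite ?unitrMl // !(uiM ui) //.
      have := Hup x Hx; have := Hg z Hy; rewrite Eg.
      rewrite -{2 3}(subrKC 1 (phi (1 + x))) -{2 3}(subrKC 1 (phi (1 + z))).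
      set X := phi (1 + x) - 1; set Z := phi (1 + z) - 1 => hZ hX.
      have -> : (1 + X) * (1 + Z) = 1 + X + Z + X * Z by ncring.
      have -> : (1 + Z) * (1 + X) = 1 + X + Z + Z * X by ncring.
      by rewrite !(upper_mul0 Hf).
    have -> : (1 + x) * (1 + z) = 1 + x + z + x * z by ncring.
    have -> : (1 + z) * (1 + x) = 1 + x + z + z * x by ncring.
    by move/addrI.
  have /upperP[ex xe] := Hx; have /upperCP[ez ze] := Hy.
  have -> : x * y * e = x * z + x * e * y * e by rewrite /z; ncring.
  by rewrite xe !mul0r addr0 -ex -mulrA xz mulrA ez mul0r.
exists f; split=> //.
  exact: (ui_upper_back ui He Hf e0 e1).
apply: (ui_upper_back ui He' (idemC Hf)) => //.
by rewrite subr1K.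
Qed.

Lemma matched_sym phi psi (e : A) (f : B) : unit_iso phi psi ->
  matched phi psi e f -> matched psi phi f e.
Proof.
move=> ui [He Hf Er H1 H2 H3 H4]; split=> //.
have Ue := unit_involution (refl_sqr He).
by case: Er => ->; [left|right];
  rewrite ?(uiN A_locmx F2 (unit_iso_sym ui)) ?(ui_unit ui) // (uiK ui) ?opprK.
Qed.

Lemma matched_neq0 phi psi (e : A) (f : B) : unit_iso phi psi ->
  e <> 0 -> 1 - e <> 0 -> matched phi psi e f -> f <> 0.
Proof.
move=> ui e0 e1 m; have [x Hx x0] := upper_neq0 (m_idem m) e0 e1.
have Ux := unit_upper (m_idem m) Hx.
have /upperP[+ _] := m_upper m Hx => + f0; rewrite f0 mul0r => /esym/eqP.
rewrite subr_eq0 => /eqP E; case: x0; apply: (@addrI _ 1); rewrite addr0.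
by apply: (ui_inj ui); rewrite ?unitr1 // E (ui1 ui).
Qed.

Lemma matched_comm phi psi (e e' : A) (f f' : B) : unit_iso phi psi ->
  matched phi psi e f -> matched phi psi e' f' -> e * e' = e' * e -> f * f' = f' * f.
Proof.
move=> ui m m' ee; apply: (comm_refl F2); apply/esym/(comm_refl F2)/esym.
have U := unit_involution (refl_sqr (m_idem m)).
have U' := unit_involution (refl_sqr (m_idem m')).
have E : phi (refl e) * phi (refl e') = phi (refl e') * phi (refl e).
  rewrite -!(uiM ui) //; congr phi.
  by apply: refl_comm; apply/esym/refl_comm/esym.
by case: (m_refl m) => ->; case: (m_refl m') => ->;
  rewrite ?mulNr ?mulrN ?opprK E.
Qed.

(** An element y of ff'B(1-f)(1-f') is upper for both f and f', so psi(1+y) - 1 lies in both eA and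
    e'A and is zero. Thus this component vanishes, and primeness splits the alternative. *)
Lemma matched_orthogonal phi psi (e e' : A) (f f' : B) : unit_iso phi psi ->
  matched phi psi e f -> matched phi psi e' f' -> e * e' = 0 -> e' * e = 0 ->
  f * f' = 0 \/ (1 - f) * (1 - f') = 0.
Proof.
move=> ui m m' ee' e'e; have ff' : f * f' = f' * f.
  by apply: (matched_comm ui m m'); rewrite ee' e'e.
have Hf := m_idemV m; have Hf' := m_idemV m'.
apply: (locally_matrix_prime B_locmx) => x.
set y := f * f' * x * ((1 - f) * (1 - f')).
have gg : (1 - f) * (1 - f') = (1 - f') * (1 - f).
  have -> : (1 - f) * (1 - f') = 1 - f - f' + f * f' by ncring.
  by rewrite ff'; ncring.
have y1 : upper f y by split; rewrite /y ?gg -!mulrA ?(idemC Hf) // !mulrA Hf.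
have y2 : upper f' y by split; rewrite /y ?ff' -!mulrA ?(idemC Hf') // !mulrA Hf'.
have [h1 _] := m_upperV m y1; have [_ h2] := m_upperV m' y2.
have /upperP[h3 _] := m_upperV m' y2.
have E : psi (1 + y) = psi 1.
  rewrite (ui1 (unit_iso_sym ui)); apply/eqP; rewrite -subr_eq0.
  by rewrite -h1 -h3 mulrA ee' mul0r.
apply: (@addrI _ 1); rewrite addr0.
by apply: (ui_inj (unit_iso_sym ui)); rewrite ?unitr1 ?(unit_upper Hf y1).
Qed.

End Matched.

(** * Systems of matrix units *)

Record matrix_units (R : nzRingType) n (E : 'I_n -> 'I_n -> R) : Prop :=
  MatrixUnits {
    mu_mul : forall i j k l, E i j * E k l = if j == k then E i l else 0;
    mu_sum : \sum_i E i i = 1 }.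

Section MatrixUnitsTheory.
Variables (R : nzRingType) (n : nat) (E : 'I_n -> 'I_n -> R).
Hypothesis muE : matrix_units E.

Lemma mu_mul1 i j k : E i j * E j k = E i k.
Proof. by rewrite (mu_mul muE) eqxx. Qed.

Lemma mu_mul0 i j k l : j != k -> E i j * E k l = 0.
Proof. by rewrite (mu_mul muE) => /negPf ->. Qed.

Lemma mu_idem i : idem (E i i).
Proof. exact: mu_mul1. Qed.

Lemma mu_corner i j : corner (E i i) (E j j) (E i j).
Proof. by split; rewrite mu_mul1. Qed.

Lemma mu_neq0 i : E i i <> 0.
Proof.
move=> Ei; have := oner_neq0 R; rewrite -(mu_sum muE) big1 ?eqxx // => j _.
by rewrite -(mu_mul1 j i) -(mu_mul1 i i j) Ei mul0r mulr0.
Qed.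

Lemma mu_neq1 i j : i != j -> 1 - E i i <> 0.
Proof.
move=> ij /eqP; rewrite subr_eq0 => /eqP E1; have := mu_neq0 (i := j).
by rewrite -[E j j]mul1r E1 mu_mul0.
Qed.

Lemma mu_decomp x : x = \sum_i \sum_j E i i * x * E j j.
Proof.
rewrite -[LHS]mul1r -[LHS]mulr1 -(mu_sum muE) !mulr_suml; apply: eq_bigr => i _.
by rewrite mulr_sumr.
Qed.

Lemma mu_cornerM i j k l x : corner (E i i) (E l l) (E i j * x * E k l).
Proof. by split; rewrite ?mulrA ?mu_mul1 // -mulrA mu_mul1. Qed.

End MatrixUnitsTheory.

(** * Extension to a ring isomorphism *)

Section Coordinatization.
Variables (A B : nzRingType) (n : nat) (o : 'I_n).
Variables (E : 'I_n -> 'I_n -> A) (F : 'I_n -> 'I_n -> B) (gam : A -> B).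
Hypotheses (muE : matrix_units E) (muF : matrix_units F).
Local Notation Co := (corner (E o o) (E o o)).
Local Notation Do := (corner (F o o) (F o o)).
Hypothesis gam_corner : forall c, Co c -> Do (gam c).
Hypothesis gamD : forall c d, Co c -> Co d -> gam (c + d) = gam c + gam d.
Hypothesis gamM : forall c d, Co c -> Co d -> gam (c * d) = gam c * gam d.
Hypothesis gam1 : gam (E o o) = F o o.
Hypothesis gam_surj : forall d, Do d -> exists2 c, Co c & gam c = d.
Hypothesis gam_inj : forall c, Co c -> gam c = 0 -> c = 0.

Let theta x := \sum_i \sum_j F i o * gam (E o i * x * E j o) * F o j.

Let C0 : Co 0. Proof. by split; rewrite ?mulr0 ?mul0r. Qed.

Let gam0 : gam 0 = 0.
Proof. by have := gamD C0 C0; rewrite addr0 => /eqP; rewrite -subr_eq0 opprD addNKr oppr_eq0 => /eqP. Qed.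

Let gamB c d : Co c -> Co d -> gam (c - d) = gam c - gam d.
Proof.
move=> Hc Hd; apply/eqP; rewrite eq_sym subr_eq -gamD ?subrK //.
exact/cornerD/cornerN.
Qed.

Let gam_sum (I : finType) (f : I -> A) : (forall i, Co (f i)) ->
  gam (\sum_i f i) = \sum_i gam (f i).
Proof.
move=> Hf; suff [] : Co (\sum_i f i) /\ gam (\sum_i f i) = \sum_i gam (f i) by [].
apply: (big_ind2 (fun x y => Co x /\ gam x = y)) => //.
by move=> x _ y _ [Hx <-] [Hy <-]; rewrite gamD //; split=> //; apply: cornerD.
Qed.

Let theta_entry i j x : F o i * theta x * F j o = gam (E o i * x * E j o).
Proof.
have [h1 h2] := gam_corner (mu_cornerM muE o i j o x).
rewrite mulr_sumr mulr_suml (bigD1 i) //= [X in _ + X]big1 ?addr0 => [|k ki].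
  rewrite mulr_sumr mulr_suml (bigD1 j) //= [X in _ + X]big1 ?addr0 => [|k kj].
    by rewrite !mulrA (mu_mul1 muF) h1 -mulrA (mu_mul1 muF) h2.
  by rewrite -!mulrA (mu_mul0 muF) ?mulr0.
by rewrite mulr_sumr mulr_suml big1 // => l _; rewrite !mulrA (mu_mul0 muF) ?mul0r // eq_sym.
Qed.

Let theta_zmod : zmod_morphism theta.
Proof.
move=> x y; rewrite /theta -sumrB; apply: eq_bigr => i _; rewrite -sumrB.
apply: eq_bigr => j _; rewrite mulrBr mulrBl gamB; try exact: mu_cornerM.
by rewrite mulrBr mulrBl.
Qed.

Let theta_monoid : monoid_morphism theta.
Proof.
split=> [|x y].
  rewrite -(mu_sum muF) /theta; apply: eq_bigr => i _.
  rewrite (bigD1 i) //= big1 ?addr0 => [|j ji].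
    by rewrite mulr1 (mu_mul1 muE) gam1 !(mu_mul1 muF).
  by rewrite mulr1 (mu_mul0 muE) 1?eq_sym // gam0 mulr0 mul0r.
rewrite (mu_decomp muF (theta x * theta y)); apply: eq_bigr => i _; apply: eq_bigr => j _.
have -> : F i i * (theta x * theta y) * F j j =
    F i o * (\sum_k (F o i * theta x * F k o) * (F o k * theta y * F j o)) * F o j.
  move: (theta x) (theta y) => X Y.
  transitivity (F i o * (F o i * X * (\sum_k F k k) * Y * F j o) * F o j).
    by rewrite (mu_sum muF) mulr1 !mulrA (mu_mul1 muF) -(mulrA _ (F j o)) (mu_mul1 muF).
  congr (_ * _ * _); rewrite !(mulr_sumr, mulr_suml); apply: eq_bigr => k _.
  by rewrite !mulrA -(mulrA _ (F k o)) (mu_mul1 muF).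
congr (_ * _ * _); have -> : E o i * (x * y) * E j o =
    \sum_k (E o i * x * E k o) * (E o k * y * E j o).
  transitivity (E o i * x * (\sum_k E k k) * y * E j o).
    by rewrite (mu_sum muE) mulr1 !mulrA.
  rewrite !(mulr_sumr, mulr_suml); apply: eq_bigr => k _.
  by rewrite !mulrA -(mulrA _ (E k o)) (mu_mul1 muE).
rewrite gam_sum => [|k]; last by apply: corner_mul; apply: mu_cornerM.
by apply: eq_bigr => k _; rewrite gamM ?theta_entry //; apply: mu_cornerM.
Qed.

(** A ring with matrix units is a matrix ring over its corner at o, so the corner isomorphism [gam]
    extends by acting on the entries. *)
Lemma coordinatization : exists theta : {rmorphism A -> B}, bijective theta /\
  forall x, theta x = \sum_i \sum_j F i o * gam (E o i * x * E j o) * F o j.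
Proof.
pose th : {rmorphism A -> B} := HB.pack theta
  (GRing.isZmodMorphism.Build A B theta theta_zmod)
  (GRing.isMonoidMorphism.Build A B theta theta_monoid).
exists th; split=> //.
have th_inj : injective th.
  apply: raddf_inj => x /= x0; rewrite (mu_decomp muE x) big1 // => i _.
  rewrite big1 // => j _; have := theta_entry i j x; rewrite x0 mulr0 mul0r.
  move/esym/(gam_inj (mu_cornerM muE o i j o x)) => H.
  rewrite -(mu_mul1 muE i o i) -(mu_mul1 muE j o j) mulrA.
  have -> : E i o * E o i * x * E j o * E o j = E i o * (E o i * x * E j o) * E o j.
    by rewrite !mulrA.
  by rewrite H mulr0 mul0r.
have /choice[inv invK] : forall y, exists x, th x = y.
  move=> y; pose P i j c := Co c /\ gam c = F o i * y * F j o.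
  have /choice[c Hc] : forall ij, exists c, P ij.1 ij.2 c.
    by move=> [i j]; have [c] := gam_surj (mu_cornerM muF o i j o y); exists c.
  exists (\sum_i \sum_j E i o * c (i, j) * E o j).
  rewrite (mu_decomp muF y) /= /theta; apply: eq_bigr => i _; apply: eq_bigr => j _.
  have -> : E o i * (\sum_k \sum_l E k o * c (k, l) * E o l) * E j o = c (i, j).
    have [[h1 h2] _] := Hc (i, j).
    rewrite mulr_sumr mulr_suml (bigD1 i) //= [X in _ + X]big1 ?addr0 => [|k ki].
      rewrite mulr_sumr mulr_suml (bigD1 j) //= [X in _ + X]big1 ?addr0 => [|k kj].
        by rewrite !mulrA (mu_mul1 muE) h1 -mulrA (mu_mul1 muE) h2.
      by rewrite -!mulrA (mu_mul0 muE) ?mulr0.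
    by rewrite mulr_sumr mulr_suml big1 // => l _; rewrite !mulrA (mu_mul0 muE) ?mul0r // eq_sym.
  have [_ /= ->] := Hc (i, j).
  by rewrite !mulrA (mu_mul1 muF) -(mulrA _ (F j o)) (mu_mul1 muF).
by exists inv => // x; apply: th_inj.
Qed.

End Coordinatization.

(** * Additive maps induced on Peirce components *)

Definition shift (R R' : nzRingType) (phi : R -> R') x := phi (1 + x) - 1.

Section Shift.
Variables (F : fieldType) (A B : unitAlgType F) (phi : A -> B) (psi : B -> A).
Hypothesis ui : unit_iso phi psi.
Local Notation alpha := (shift phi).
Local Notation m := (matched phi psi).

Lemma shiftE x : phi (1 + x) = 1 + alpha x.
Proof. by rewrite /shift subrKC. Qed.

Lemma shift0 : alpha 0 = 0.
Proof. by rewrite /shift addr0 (ui1 ui) subrr. Qed.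

Lemma shiftK e x : idem e -> upper e x -> shift psi (alpha x) = x.
Proof. by move=> He Hx; rewrite /shift subrKC (uiK ui) ?add1K // (unit_upper He). Qed.

Lemma shiftVK f y : idem f -> upper f y -> alpha (shift psi y) = y.
Proof.
by move=> Hf Hy; rewrite /shift subrKC (uiVK ui) ?add1K // (unit_upper Hf).
Qed.

Lemma shift_eq0 e x : idem e -> upper e x -> alpha x = 0 -> x = 0.
Proof.
move=> He Hx E; rewrite -(shiftK He Hx) E /shift addr0.
by rewrite (ui1 (unit_iso_sym ui)) subrr.
Qed.

Lemma shiftD e f x y : m e f -> upper e x -> upper e y ->
  alpha (x + y) = alpha x + alpha y.
Proof.
move=> mef Hx Hy; have He := m_idem mef.
have : phi ((1 + x) * (1 + y)) = phi (1 + x) * phi (1 + y).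
  by rewrite (uiM ui) ?(unit_upper He).
have -> : (1 + x) * (1 + y) = 1 + (x + y) + x * y by ncring.
rewrite (upper_mul0 He) // addr0 !shiftE => H.
apply: (@addrI _ 1); rewrite H.
have := m_upper mef Hx; have := m_upper mef Hy; rewrite -!/(shift _ _).
move: (alpha x) (alpha y) => X Y HY HX.
have -> : (1 + X) * (1 + Y) = 1 + (X + Y) + X * Y by ncring.
by rewrite (upper_mul0 (m_idemV mef)) // addr0.
Qed.

Lemma shift_sum e f (I : finType) (P : pred I) (x : I -> A) : m e f ->
  (forall i, P i -> upper e (x i)) ->
  alpha (\sum_(i | P i) x i) = \sum_(i | P i) alpha (x i).
Proof.
move=> mef Hx.
suff [] : upper e (\sum_(i | P i) x i) /\
  alpha (\sum_(i | P i) x i) = \sum_(i | P i) alpha (x i) by [].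
apply: (big_ind2 (fun a b => upper e a /\ alpha a = b)).
- by split; [split; rewrite ?mulr0 ?mul0r | exact: shift0].
- move=> a _ b _ [Ha <-] [Hb <-]; split; first exact: cornerD.
  by rewrite (shiftD mef).
- by move=> i /Hx.
Qed.

(** The matching of e controls the left side of the image and that of e' the right side. *)
Lemma shift_corner e e' f f' x : m e f -> m e' f' -> e * e' = 0 -> e' * e = 0 ->
  corner e e' x -> corner f f' (alpha x).
Proof.
move=> mef mef' h h' /(corner_upper h h')[/(m_upper mef)[Hf _]].
by move=> /(m_lower mef')[_]; rewrite subr1K.
Qed.

(** This is the image of the commutator relation (1+x)(1+y) = (1+xy)(1+y)(1+x). Orthogonality
    removes all terms of its expansion in B except the product of the images of x and y. *)
Lemma shiftM e1 e2 e3 f1 f2 f3 x y : m e1 f1 -> m e2 f2 -> m e3 f3 ->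
  e1 * e2 = 0 -> e2 * e1 = 0 -> e2 * e3 = 0 -> e3 * e2 = 0 ->
  e1 * e3 = 0 -> e3 * e1 = 0 ->
  f2 * f1 = 0 -> f3 * f2 = 0 -> f3 * f1 = 0 ->
  corner e1 e2 x -> corner e2 e3 y -> alpha (x * y) = alpha x * alpha y.
Proof.
move=> m1 m2 m3 e12 e21 e23 e32 e13 e31 f21 f32 f31 Hx Hy.
have Hxy : corner e1 e3 (x * y) by apply: corner_mul Hx Hy.
have [Ux _] := corner_upper e12 e21 Hx; have [Uy _] := corner_upper e23 e32 Hy.
have [Uxy _] := corner_upper e13 e31 Hxy.
have ux := unit_upper (m_idem m1) Ux; have uy := unit_upper (m_idem m2) Uy.
have uxy := unit_upper (m_idem m1) Uxy.
have HX := shift_corner m1 m2 e12 e21 Hx; have HY := shift_corner m2 m3 e23 e32 Hy.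
have HZ := shift_corner m1 m3 e13 e31 Hxy.
have E : (1 + x) * (1 + y) = (1 + x * y) * ((1 + y) * (1 + x)).
  have -> : (1 + x * y) * ((1 + y) * (1 + x)) =
    (1 + x) * (1 + y) + y * x + x * y * x + x * (y * y) + x * (y * y) * x by ncring.
  by rewrite (corner_mul0 e31 Hy Hx) (corner_mul0 e32 Hy Hy)
    (corner_mul0 e31 Hxy Hx) !mulr0 mul0r !addr0.
have := congr1 phi E; rewrite !(uiM ui) ?unitrMl // !shiftE.
move: (alpha x) (alpha y) (alpha (x * y)) HX HY HZ => X Y Z HX HY HZ.
have -> : (1 + Z) * ((1 + Y) * (1 + X)) =
  1 + X + Y + Z + Y * X + Z * X + Z * Y + Z * (Y * X) by ncring.
have -> : (1 + X) * (1 + Y) = 1 + X + Y + X * Y by ncring.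
rewrite (corner_mul0 f31 HY HX) (corner_mul0 f31 HZ HX) (corner_mul0 f32 HZ HY).
by rewrite mulr0 !addr0 => /addrI.
Qed.

End Shift.

(** * Matching the diagonal of a system of matrix units *)

Lemma exists_ord_neq2 n (i j : 'I_n.+3) : exists k : 'I_n.+3, (k != i) && (k != j).
Proof.
apply/existsP; rewrite -[[exists _, _]]negbK negb_exists; apply/negP => /forallP H.
have : (#|'I_n.+3| <= #|pred2 i j|)%N.
  by apply: subset_leq_card; apply/subsetP => k _; have := H k; rewrite inE negb_and !negbK.
by rewrite card_ord card2; case: (_ == _).
Qed.

Section Families.
Variables (F : fieldType) (A B : unitAlgType F).
Hypotheses (A_locmx : locally_matrix A) (B_locmx : locally_matrix B).
Hypotheses (F2 : 2%:R != 0 :> F) (F3 : 3%:R != 0 :> F).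
Variables (phi : A -> B) (psi : B -> A).
Hypothesis ui : unit_iso phi psi.

Lemma matched_cent e f u : matched phi psi e f -> u \is a GRing.unit ->
  f * u = u * f -> e * psi u = psi u * e.
Proof.
move=> m Uu fu; apply: (comm_refl F2); apply: (ui_inj ui).
- by rewrite unitrMl ?(ui_unitV ui) ?(unit_involution (refl_sqr (m_idem m))).
- by rewrite unitrMl ?(ui_unitV ui) ?(unit_involution (refl_sqr (m_idem m))).
rewrite !(uiM ui) ?(ui_unitV ui) ?(unit_involution (refl_sqr (m_idem m))) //.
rewrite (uiVK ui) //; have := refl_comm fu.
by case: (m_refl m) => ->; rewrite ?mulNr ?mulrN // => /oppr_inj.
Qed.

(** If the sum s were not 1, there would be a nonzero y in f_o B(1-s). For i other than o, 1+y
    commutes with f_i, so x = psi(1+y) - 1 commutes with E_ii. As x lies in E_oo A(1-E_oo), each x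
    E_ii is zero, hence x = 0 and y = 0. *)
Lemma matched_sum n (E : 'I_n.+2 -> 'I_n.+2 -> A) (f : 'I_n.+2 -> B) :
  matrix_units E -> (forall i, matched phi psi (E i i) (f i)) ->
  (forall i j, i != j -> f i * f j = 0) -> \sum_i f i = 1.
Proof.
move=> muE m orth; set s := \sum_i f i.
have Hf i := m_idemV (m i).
have sf i : s * f i = f i.
  rewrite mulr_suml (bigD1 i) //= Hf big1 ?addr0 // => j ji.
  by rewrite orth.
have Hs : idem s by rewrite /idem {2}/s mulr_sumr; apply: eq_bigr => i _; apply: sf.
apply: contrapT => /eqP; rewrite eq_sym -subr_eq0 => /eqP s1.
pose o : 'I_n.+2 := ord0; have f0 : f o <> 0.
  apply: (matched_neq0 A_locmx ui _ _ (m o)); first exact: mu_neq0 muE _.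
  exact: (mu_neq1 muE (j := ord_max)).
have [y [yl yr] y0] := corner_neq0 B_locmx (Hf o) (idemC Hs) f0 s1.
have yf i : y * f i = 0 by rewrite -yr -mulrA mulrBl mul1r sf subrr mulr0.
have fy i : i != o -> f i * y = 0 by move=> io; rewrite -yl mulrA orth // mul0r.
have Uy : upper (f o) y by apply/upperP.
have Hx := m_upperV (m o) Uy; rewrite -/(shift psi y) in Hx.
have xE : psi (1 + y) = 1 + shift psi y by rewrite shiftE.
case: y0; rewrite -(shiftVK ui (Hf o) Uy).
suff -> : shift psi y = 0 by rewrite (shift0 ui).
move: (shift psi y) Hx xE => x /upperP[ex xe] xE.
rewrite -[x]mulr1 -(mu_sum muE) mulr_sumr big1 // => i _.
case: (eqVneq i o) => [->//|io].
have := matched_cent (m i) (unit_upper (Hf o) Uy).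
rewrite xE !mulrDl !mulrDr !mul1r !mulr1 yf fy // => /(_ erefl) /addrI <-.
by rewrite -ex mulrA (mu_mul0 muE) // mul0r.
Qed.

Lemma matched_family n (E : 'I_n.+3 -> 'I_n.+3 -> A) : matrix_units E ->
  exists f : 'I_n.+3 -> B, (forall i, matched phi psi (E i i) (f i)) /\
    ((forall i j, i != j -> f i * f j = 0) \/
     (forall i j, i != j -> (1 - f i) * (1 - f j) = 0)).
Proof.
move=> muE; have E0 i := mu_neq0 muE (i := i).
have other := @exists_ord_neq2 n.
have E1 i : 1 - E i i <> 0.
  by have [j /andP[ji _]] := other i i; apply: (mu_neq1 muE (j := j)); rewrite eq_sym.
have /choice[f m] : forall i, exists f, matched phi psi (E i i) f.
  by move=> i; apply: (matched_ex A_locmx B_locmx F2 F3 ui (mu_idem muE i)).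
exists f; split=> //.
have f0 i : f i <> 0 := matched_neq0 A_locmx ui (E0 i) (E1 i) (m i).
have f1 i : 1 - f i <> 0.
  apply: (matched_neq0 A_locmx ui _ _ (matchedC B_locmx F2 ui (m i))) => //.
  by rewrite subr1K.
have fC i j : f i * f j = f j * f i.
  by apply: (matched_comm F2 ui (m i) (m j)); rewrite !(mu_mul muE) eq_sym; case: eqP => [->|].
have D i j : i != j -> f i * f j = 0 \/ (1 - f i) * (1 - f j) = 0.
  by move=> ij; apply: (matched_orthogonal B_locmx F2 ui (m i) (m j)); rewrite (mu_mul0 muE) // eq_sym.
(* Two pairs sharing an index take the same alternative: otherwise either alternative for the
   remaining pair forces f_j = 0 or f_k = 1. The alternative of one pair therefore spreads to all
   pairs. *)
have mixed i j k : i != j -> i != k -> j != k ->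
    f i * f j = 0 -> (1 - f i) * (1 - f k) = 0 -> False.
  move=> ij ik jk Eij Eik; have [Ejk|Ejk] := D j k jk.
    apply: (f0 j); have -> : f j = f j * ((1 - f i) * (1 - f k)) + f j * f i
       + f j * f k - f j * f i * f k by ncring.
    by rewrite Eik -(fC i) Eij Ejk mul0r mulr0 !addr0 subr0.
  apply: (f1 k); have -> : 1 - f k = (1 - f i) * (1 - f k) +
     f i * ((1 - f j) * (1 - f k)) + f i * f j * (1 - f k) by ncring.
  by rewrite Eik Ejk Eij mulr0 mul0r !addr0.
have cmp i j : (1 - f i) * (1 - f j) = (1 - f j) * (1 - f i).
  have -> : (1 - f i) * (1 - f j) = 1 - f i - f j + f i * f j by ncring.
  by rewrite fC; ncring.
have step i j k : i != j -> i != k -> f i * f j = 0 -> f i * f k = 0.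
  move=> ij ik Eij; case: (eqVneq j k) => [<-//|jk].
  by case: (D i k ik) => // /(mixed i j k ij ik jk Eij).
have step' i j k : i != j -> i != k ->
    (1 - f i) * (1 - f j) = 0 -> (1 - f i) * (1 - f k) = 0.
  move=> ij ik Eij; case: (eqVneq j k) => [<-//|jk].
  by case: (D i k ik) => // H; case: (mixed i k j ik ij _ H Eij); rewrite eq_sym.
have o1 : (ord0 : 'I_n.+3) != ord_max by [].
have [Eo|Eo] := D _ _ o1; [left|right] => i j ij.
  case: (eqVneq i ord0) ij => [->|i0] ij; first exact: step Eo.
  apply: (step i ord0) => //; rewrite fC; apply: step Eo => //.
  by rewrite eq_sym.
case: (eqVneq i ord0) ij => [->|i0] ij; first exact: step' Eo.
apply: (step' i ord0) => //; rewrite cmp; apply: step' Eo => //.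
by rewrite eq_sym.
Qed.

End Families.

(** * The ring isomorphism built from a matched family *)

Section Frame.
Variables (F : fieldType) (A B : unitAlgType F).
Hypotheses (A_locmx : locally_matrix A) (B_locmx : locally_matrix B).
Hypotheses (F2 : 2%:R != 0 :> F) (F3 : 3%:R != 0 :> F).
Variables (phi : A -> B) (psi : B -> A).
Hypothesis ui : unit_iso phi psi.
Local Notation alpha := (shift phi).

Definition agree e (theta : A -> B) :=
  (forall x, upper e x -> theta x = alpha x) /\
  (forall x, upper (1 - e) x -> theta x = alpha x).

Section Extension.
Variables (n : nat) (E : 'I_n -> 'I_n -> A) (f : 'I_n -> B) (o i1 : 'I_n).
Hypothesis muE : matrix_units E.
Hypothesis o1 : i1 != o.
Hypothesis m : forall i, matched phi psi (E i i) (f i).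
Hypothesis orth : forall i j, i != j -> f i * f j = 0.

(** The candidate matrix units of B. The diagonal needs its own clause, because 1 + E_ii is not a
    transvection. *)
Definition frame i j := if i == j then f i else alpha (E i j).
(** The shift is additive only off the diagonal, so c in the corner at o is moved to the component
    (o, i1), shifted there and moved back. *)
Definition gam c := alpha (c * E o i1) * frame i1 o.

Let frameE i j : i != j -> frame i j = alpha (E i j).
Proof. by rewrite /frame => /negPf ->. Qed.

Lemma frame_shift_corner i j x : i != j -> corner (E i i) (E j j) x ->
  corner (f i) (f j) (alpha x).
Proof.
move=> ij; apply: (shift_corner (m i) (m j)); rewrite (mu_mul0 muE) //.
by rewrite eq_sym.
Qed.

Lemma frame_corner i j : corner (f i) (f j) (frame i j).
Proof.
rewrite /frame; case: eqVneq => [->|ij]; first by split; apply: m_idemV (m _).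
by apply: frame_shift_corner => //; apply: mu_corner.
Qed.

Lemma frame_upper i j x : i != j -> corner (E i i) (E j j) x ->
  upper (E i i) x /\ upper (1 - E j j) x.
Proof.
by move=> ij; apply: corner_upper; rewrite (mu_mul0 muE) // eq_sym.
Qed.

Lemma frame_shift_surj i j y : i != j -> corner (f i) (f j) y ->
  exists2 x, corner (E i i) (E j j) x & alpha x = y.
Proof.
move=> ij Hy; exists (shift psi y).
  apply: (shift_corner (matched_sym A_locmx F2 ui (m i)) (matched_sym A_locmx F2 ui (m j))) Hy.
    by rewrite orth.
  by rewrite orth // eq_sym.
apply: (shiftVK ui (m_idemV (m i))).
by apply: (corner_upper _ _ Hy).1; rewrite orth // eq_sym.
Qed.

Lemma frame_shift_inj i j x : i != j -> corner (E i i) (E j j) x ->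
  alpha x = 0 -> x = 0.
Proof.
by move=> ij /(frame_upper ij)[Hx _]; apply: (shift_eq0 ui (m_idem (m i)) Hx).
Qed.

Lemma frame_shiftD i j x y : i != j -> corner (E i i) (E j j) x ->
  corner (E i i) (E j j) y -> alpha (x + y) = alpha x + alpha y.
Proof.
by move=> ij /(frame_upper ij)[Hx _] /(frame_upper ij)[Hy _]; apply: (shiftD ui (m i)).
Qed.

Lemma frame_shiftM i j k x y : i != j -> j != k -> i != k ->
  corner (E i i) (E j j) x -> corner (E j j) (E k k) y ->
  alpha (x * y) = alpha x * alpha y.
Proof.
move=> ij jk ik Hx Hy.
have [ji kj ki] : [/\ j != i, k != j & k != i] by rewrite ![_ == i]eq_sym (eq_sym k).
by apply: (shiftM ui (m i) (m j) (m k)); rewrite ?(mu_mul0 muE) ?orth.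
Qed.

Section Build.
Hypothesis muF : matrix_units frame.
Hypothesis gamM : forall c d, corner (E o o) (E o o) c -> corner (E o o) (E o o) d ->
  gam (c * d) = gam c * gam d.
Hypothesis gam_indep : forall j c, j != o -> corner (E o o) (E o o) c ->
  gam c = alpha (c * E o j) * frame j o.
Hypothesis gam_low : forall j x, j != o -> corner (E j j) (E o o) x ->
  frame j o * gam (E o j * x) = alpha x.

(** After coordinatization, [gam_indep] identifies theta with the shift on row o and [gam_low] on
    column o. The off-diagonal parts of that row and column add up to the two components required by
    [agree]. *)
Lemma extension : exists2 theta : {rmorphism A -> B}, bijective theta &
  agree (E o o) theta.
Proof.
have oo1 : o != i1 by rewrite eq_sym.
have foo : frame o o = f o by rewrite /frame eqxx.
have cE c : corner (E o o) (E o o) c -> corner (E o o) (E i1 i1) (c * E o i1).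
  by move=> Hc; apply: corner_mul Hc (mu_corner muE _ _).
have [||||||theta [theta_bij thetaE]] := @coordinatization A B n o E frame gam muE muF.
- move=> c Hc; rewrite foo; apply: corner_mul (frame_corner _ _).
  exact/frame_shift_corner/cE.
- move=> c d Hc Hd; rewrite /gam (mulrDl c d) (frame_shiftD oo1) ?mulrDl //; exact: cE.
- exact: gamM.
- by rewrite /gam (mu_mul1 muE) -frameE // (mu_mul1 muF).
- move=> d; rewrite foo => Hd.
  have [|x Hx Ex] := @frame_shift_surj o i1 (d * frame o i1) oo1.
    by apply: corner_mul Hd (frame_corner _ _).
  exists (x * E i1 o); first exact: corner_mul Hx (mu_corner muE _ _).
  rewrite /gam -mulrA (mu_mul1 muE); have [_ ->] := Hx.
  by rewrite Ex -mulrA (mu_mul1 muF) foo; have [_ ->] := Hd.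
- move=> c Hc H; have /(frame_shift_inj oo1 (cE c Hc)) E0 : alpha (c * E o i1) = 0.
    have [_ <-] := frame_shift_corner oo1 (cE c Hc).
    have -> : f i1 = frame i1 o * frame o i1 by rewrite (mu_mul1 muF) /frame eqxx.
    by rewrite mulrA -/(gam c) H mul0r.
  have [_ <-] := Hc; rewrite -(mu_mul1 muE o i1 o) mulrA E0 mul0r //.
exists theta => //.
have gam0 : gam 0 = 0 by rewrite /gam mul0r (shift0 ui) mul0r.
have entry i j x : corner (E i i) (E j j) x ->
    theta x = frame i o * gam (E o i * x * E j o) * frame o j.
  move=> [h1 h2]; rewrite thetaE (bigD1 i) //= [X in _ + X]big1 ?addr0 => [|k ki].
    rewrite (bigD1 j) //= [X in _ + X]big1 ?addr0 // => k kj.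
    have -> : E o i * x * E k o = 0.
      by rewrite -h2 -!mulrA (mu_mul0 muE) ?mulr0 // eq_sym.
    by rewrite gam0 mulr0 mul0r.
  rewrite big1 // => l _; have -> : E o k * x * E l o = 0.
    by rewrite -h1 !mulrA (mu_mul0 muE) ?mul0r.
  by rewrite gam0 mulr0 mul0r.
have rowE j x : j != o -> corner (E o o) (E j j) x -> theta x = alpha x.
  move=> jo Hx; have oj : o != j by rewrite eq_sym.
  rewrite (entry o j) //; have Hxo := corner_mul Hx (mu_corner muE j o).
  have [-> _] := Hx; rewrite (gam_indep jo) // -(mulrA x) (mu_mul1 muE).
  have [_ ->] := Hx; rewrite foo mulrA -mulrA (mu_mul1 muF) /frame eqxx.
  by have [-> ->] := frame_shift_corner oj Hx.
have colE j x : j != o -> corner (E j j) (E o o) x -> theta x = alpha x.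
  move=> jo Hx; rewrite (entry j o) // foo -(mulrA (E o j)); have [_ ->] := Hx.
  rewrite gam_low //; by have [_ ->] := frame_shift_corner jo Hx.
split=> x Hx; have /upperP[h1 h2] := Hx.
  have xE : x = \sum_(j | j != o) x * E j j.
    by rewrite -[LHS]mulr1 -(mu_sum muE) mulr_sumr (bigD1 o) //= h2 add0r.
  have Hxj j : corner (E o o) (E j j) (x * E j j).
    by split; rewrite ?mulrA ?h1 // -mulrA (mu_mul1 muE).
  rewrite xE raddf_sum (shift_sum ui (m o)) /=.
    by apply: eq_bigr => j jo; apply: (rowE _ _ jo (Hxj j)).
  by move=> j jo; apply: (frame_upper _ (Hxj j)).1; rewrite eq_sym.
have /upperCP[h3 h4] := Hx.
have xE : x = \sum_(j | j != o) E j j * x.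
  by rewrite -[LHS]mul1r -(mu_sum muE) mulr_suml (bigD1 o) //= h3 add0r.
have Hxj j : corner (E j j) (E o o) (E j j * x).
  by split; rewrite ?mulrA ?(mu_mul1 muE) // -mulrA h4.
rewrite xE raddf_sum (shift_sum ui (matchedC B_locmx F2 ui (m o))) /=.
  by apply: eq_bigr => j jo; apply: (colE _ _ jo (Hxj j)).
by move=> j jo; apply: (frame_upper _ (Hxj j)).2.
Qed.

End Build.
End Extension.

(** A third index makes [frame_shiftM] applicable: relations that would pass through a diagonal
    component are multiplied into another column first. *)
Lemma extension_ge3 n (E : 'I_n.+3 -> 'I_n.+3 -> A) (f : 'I_n.+3 -> B) :
  matrix_units E -> (forall i, matched phi psi (E i i) (f i)) ->
  (forall i j, i != j -> f i * f j = 0) ->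
  exists2 theta : {rmorphism A -> B}, bijective theta & agree (E ord0 ord0) theta.
Proof.
move=> muE m orth; pose fr := frame E f.
have frC i j : corner (f i) (f j) (fr i j) := frame_corner muE m i j.
have frE i j : i != j -> fr i j = alpha (E i j) by rewrite /fr /frame => /negPf ->.
have frd i : fr i i = f i by rewrite /fr /frame eqxx.
have other := @exists_ord_neq2 n.
have sM i j k x y : i != j -> j != k -> i != k ->
    corner (E i i) (E j j) x -> corner (E j j) (E k k) y ->
    alpha (x * y) = alpha x * alpha y.
  by move=> ij jk ik; apply: (frame_shiftM muE m orth).
have frM i j k : i != j -> j != k -> i != k -> fr i j * fr j k = fr i k.
  move=> ij jk ik; rewrite !frE // -(mu_mul1 muE i j k).
  by rewrite (sM i j k) //; apply: mu_corner muE _ _.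
have f0 i : f i <> 0.
  have [j /andP[ji _]] := other i i.
  apply: (matched_neq0 A_locmx ui (mu_neq0 muE (i := i)) _ (m i)).
  by apply: (mu_neq1 muE (j := j)); rewrite eq_sym.
(* For a third index k, both sides act alike on f_i B f_k, which consists of shifts of elements x of
   E_ii A E_kk, since E_ij E_ji x = x. Primeness then gives equality. *)
have frV i j : i != j -> fr i j * fr j i = f i.
  move=> ij; have ji : j != i by rewrite eq_sym.
  have [k /andP[ki kj]] := other i j.
  have ik : i != k by rewrite eq_sym. have jk : j != k by rewrite eq_sym.
  suff [|/f0 //] : f i - fr i j * fr j i = 0 \/ f k = 0.
    by move=> /eqP; rewrite subr_eq0 => /eqP.
  apply: (locally_matrix_prime B_locmx) => z.
  have Hz : corner (f i) (f k) (f i * z * f k) by apply: cornerM; apply: m_idemV (m _).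
  have -> : (f i - fr i j * fr j i) * z * f k =
      f i * z * f k - fr i j * (fr j i * (f i * z * f k)).
    have [_ E1] := frC j i.
    by rewrite !mulrBl !mulrA -(mulrA _ (fr j i) (f i)) E1.
  have [x Hx <-] := frame_shift_surj m orth ik Hz.
  have Hji := mu_corner muE j i.
  rewrite !frE // -(sM j i k) //.
  rewrite -(sM i j k) //; try exact: mu_corner muE _ _; last exact: corner_mul Hji Hx.
  by rewrite mulrA (mu_mul1 muE); have [-> _] := Hx; rewrite subrr.
have muF : matrix_units fr.
  split=> [i j k l|]; last first.
    under eq_bigr do rewrite frd.
    exact: (matched_sum A_locmx B_locmx F2 ui muE m orth).
  case: (eqVneq j k) => [<-|jk]; last first.
    by apply: corner_mul0 (frC i j) (frC k l); apply: orth.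
  case: (eqVneq i j) => [<-|ij]; first by rewrite frd; have [] := frC i l.
  case: (eqVneq j l) => [<-|jl]; first by rewrite frd; have [] := frC i j.
  by case: (eqVneq i l) => [<-|il]; [rewrite frV ?frd | apply: frM].
pose o : 'I_n.+3 := ord0; pose l : 'I_n.+3 := ord_max.
have lo : l != o by []. have ol : o != l by [].
have cE j c : corner (E o o) (E o o) c -> corner (E o o) (E j j) (c * E o j).
  by move=> Hc; apply: corner_mul Hc (mu_corner muE _ _).
have indep j c : j != o -> corner (E o o) (E o o) c ->
    gam E f o l c = alpha (c * E o j) * fr j o.
  move=> jo Hc; have oj : o != j by rewrite eq_sym.
  case: (eqVneq j l) => [->//|jl]; have lj : l != j by rewrite eq_sym.
  rewrite /gam -/(fr l o) -(mu_mul1 muE o l j) mulrA (sM o l j) //.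
  - by rewrite -frE // -mulrA (mu_mul1 muF).
  - exact: cE.
  - exact: mu_corner muE _ _.
apply: (@extension _ E f o l) => //.
(* Computing gam d and gam(cd) through k, and gam c through l, leaves only products of shifts along
   distinct indices. *)
- move=> c d Hc Hd; have [k /andP[ko kl]] := other o l.
  have ok : o != k by rewrite eq_sym. have lk : l != k by rewrite eq_sym.
  rewrite (indep k d) // (indep k (c * d)) //; last exact: corner_mul Hc Hd.
  rewrite /gam -/(fr l o) mulrA; congr (_ * _).
  have Eld : corner (E l l) (E k k) (E l o * (d * E o k)).
    by apply: corner_mul (mu_corner muE l o) (cE k d Hd).
  have Hok := cE k d Hd.
  rewrite -(mulrA (alpha _)) frE // -(sM l o k) //; last exact: mu_corner muE _ _.
  rewrite -(sM o l k) //; last exact: cE.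
  by rewrite -!mulrA (mulrA (E o l)) (mu_mul1 muE); have [-> _] := Hok.
move=> j x jo Hx; have [k /andP[ko kj]] := other o j.
have oj : o != j by rewrite eq_sym. have ok : o != k by rewrite eq_sym.
have jk : j != k by rewrite eq_sym.
have Ejx : corner (E o o) (E o o) (E o j * x) := corner_mul (mu_corner muE o j) Hx.
rewrite (indep k) // -/(fr j o) mulrA (frE j o) // -(sM j o k) //.
- have -> : E j o * (E o j * x * E o k) = x * E o k.
    by rewrite !mulrA (mu_mul1 muE); have [-> _] := Hx.
  rewrite (sM j o k) //; last exact: mu_corner muE _ _.
  rewrite -frE // -mulrA (mu_mul1 muF) frd.
  by have [_ ->] := frame_shift_corner muE m jo Hx.
- exact: mu_corner muE _ _.
- exact: cE.
Qed.

End Frame.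

(** * Two by two matrices *)

Section RankTwo.
Variables (F : fieldType) (A B : unitAlgType F).
Hypotheses (A_locmx : locally_matrix A) (B_locmx : locally_matrix B).
Hypotheses (F2 : 2%:R != 0 :> F) (F3 : 3%:R != 0 :> F).
Variables (phi : A -> B) (psi : B -> A).
Hypothesis ui : unit_iso phi psi.
Local Notation alpha := (shift phi).

(** The factorisation of an antidiagonal Weyl element into three transvections, as in SL_2. *)
Lemma weyl_eq (R : nzRingType) (e x y : R) : idem e ->
  upper e x -> upper (1 - e) y -> x * y = - e -> y * x = - (1 - e) ->
  (1 + x) * (1 + y) * (1 + x) = x + y.
Proof.
move=> He Hx Hy xy yx; have /upperP[ex xe] := Hx.
have -> : (1 + x) * (1 + y) * (1 + x) =
  1 + x + y + x * y + x + x * x + y * x + x * y * x by ncring.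
rewrite xy yx (upper_sqr He Hx) mulNr ex; ncring.
Qed.

(** The Weyl element w = x+y anticommutes with [refl e], so phi(w) anticommutes with [refl f] and
    has zero diagonal blocks. With X and Y the shifts of x and y, expanding phi(w) shows these
    blocks to be f + XY and (1-f) + YX. *)
Lemma shift_weyl e f x y : matched phi psi e f -> upper e x -> upper (1 - e) y ->
  x * y = - e -> y * x = - (1 - e) ->
  alpha x * alpha y = - f /\ alpha y * alpha x = - (1 - f).
Proof.
move=> m Hx Hy xy yx; have He := m_idem m; have Hf := m_idemV m.
have mC := matchedC B_locmx F2 ui m.
have Ux := unit_upper He Hx; have Uy := unit_upper (m_idem mC) Hy.
set w := (1 + x) * (1 + y) * (1 + x).
have Uw : w \is a GRing.unit by rewrite /w unitrMl // unitrMl.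
have wE : w = x + y by exact: (weyl_eq He Hx Hy xy yx).
have Ue := unit_involution (refl_sqr He).
have anti : refl e * w = - (w * refl e).
  have [h1 h2] := refl_upper Hx; have := refl_upper Hy.
  rewrite reflC mulNr mulrN => -[/oppr_inj h3 h4].
  rewrite wE (mulrDr (refl e)) (mulrDl x y) h1 h2 h3 -[y * refl e]opprK h4; ncring.
have antiV : refl f * phi w = - (phi w * refl f).
  have : phi (refl e) * phi w = - (phi w * phi (refl e)).
    by rewrite -!(uiM ui) // anti (uiN B_locmx F2 ui) // unitrMl.
  by case: (m_refl m) => ->; rewrite ?mulNr ?mulrN => ->.
have WE : phi w = f * phi w + phi w * f.
  apply: (addrr_inj F2); apply/eqP; rewrite -subr_eq0; apply/eqP.
  transitivity (refl f * phi w + phi w * refl f); first by rewrite /refl; ncring.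
  by rewrite antiV addNr.
have Wff : f * phi w * f = 0.
  have := congr1 (fun z => f * z * f) WE; rewrite /= => E.
  have : f * phi w * f = f * f * phi w * f + f * phi w * (f * f) by rewrite {1}E; ncring.
  by rewrite Hf => /eqP; rewrite -subr_eq0 opprD addNKr oppr_eq0 => /eqP.
have Wgg : (1 - f) * phi w * (1 - f) = 0.
  have -> : (1 - f) * phi w * (1 - f) =
    phi w - (f * phi w + phi w * f) + f * phi w * f by ncring.
  by rewrite -WE subrr Wff addr0.
have phiw : phi w = (1 + alpha x) * (1 + alpha y) * (1 + alpha x).
  by rewrite !(uiM ui) ?unitrMl // !(shiftE phi).
have := m_upper m Hx; have := m_upper mC Hy; rewrite -!/(shift _ _).
move: Wff Wgg; rewrite phiw; move: (alpha x) (alpha y) => X Y Wff Wgg HY HX.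
have /upperP[fX Xf] := HX; have /upperCP[fY Yf] := HY.
split.
  have <- : f * ((1 + X) * (1 + Y) * (1 + X)) * f - f = X * Y.
    have -> : f * ((1 + X) * (1 + Y) * (1 + X)) * f - f =
      (f * f - f) + f * (X * f) + f * Y * f + f * Y * (X * f) + (f * X) * f
      + f * X * (X * f) + (f * X) * (Y * f) + f * X * Y * (X * f) by ncring.
    by rewrite Hf subrr Xf fX fY Yf !mulr0 !mul0r !addr0 !add0r Xf add0r.
  by rewrite Wff sub0r.
have <- : (1 - f) * ((1 + X) * (1 + Y) * (1 + X)) * (1 - f) - (1 - f) = Y * X.
  have X1 : X * (1 - f) = X by rewrite mulrBr mulr1 Xf subr0.
  have Y1 : (1 - f) * Y = Y by rewrite mulrBl mul1r fY subr0.
  have X2 : (1 - f) * X = 0 by rewrite mulrBl mul1r fX subrr.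
  have Y2 : Y * (1 - f) = 0 by rewrite mulrBr mulr1 Yf subrr.
  have -> : (1 - f) * ((1 + X) * (1 + Y) * (1 + X)) * (1 - f) - (1 - f) =
    ((1 - f) * (1 - f) - (1 - f)) + (1 - f) * X * (1 - f)
     + (1 - f) * (Y * (1 - f)) + (1 - f) * Y * (X * (1 - f))
     + (1 - f) * X * ((1 + Y) * (1 + X) * (1 - f)) by ncring.
  by rewrite (idemC Hf) subrr X1 Y1 X2 Y2 !mulr0 !mul0r !addr0 !add0r.
by rewrite Wgg sub0r.
Qed.

Lemma shiftN e f x : matched phi psi e f -> upper e x -> alpha (- x) = - alpha x.
Proof.
move=> m Hx; apply/eqP; rewrite -subr_eq0 opprK -(shiftD ui m) //; last exact: cornerN.
by rewrite addNr (shift0 ui).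
Qed.

(** Polarise the identity for squares and divide by 2. *)
Lemma jordan_mul (S : comNzRingType) (R : unitAlgType F) (g : S -> R) :
  {morph g : a b / a + b} -> (forall a, g (a * a) = g a * g a) ->
  (forall a b, g a * g b = g b * g a) -> {morph g : a b / a * b}.
Proof.
move=> gD gsq gC a b; apply: (addrr_inj F2).
have : g ((a + b) * (a + b)) = (g a + g b) * (g a + g b) by rewrite gsq gD.
have -> : (a + b) * (a + b) = a * a + (a * b + a * b) + b * b.
  by rewrite mulrDl !mulrDr (mulrC b a) !addrA.
have -> : (g a + g b) * (g a + g b) = g a * g a + (g a * g b + g a * g b) + g b * g b.
  by rewrite mulrDl !mulrDr (gC b a) !addrA.
by rewrite !gD !gsq => /addIr /addrI.
Qed.

(** Without a third index, multiplicativity of G comes from the diagonal elements h a: they commute,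
    and they scale transvections by squares, so [jordan_mul] applies. *)
Lemma extension_2 (E : 'I_2 -> 'I_2 -> A) f : matrix_units E ->
  matched phi psi (E ord0 ord0) f ->
  (forall x, exists c : F, E ord0 ord0 * x * E ord0 ord0 = c *: E ord0 ord0) ->
  exists2 theta : {rmorphism A -> B}, bijective theta & agree phi (E ord0 ord0) theta.
Proof.
move=> muE m scal; pose o : 'I_2 := ord0; pose l : 'I_2 := ord_max.
have lo : l != o by []. have ol : o != l by [].
have E1 : 1 - E o o = E l l.
  by rewrite -(mu_sum muE) (bigD1 o) //= (bigD1 l) //= big1 ?addr0 ?addrK ?(addrC (E o o)) ?addrK // => -[[|[]]].
pose ff (i : 'I_2) := if i == o then f else 1 - f.
have two (i : 'I_2) : i != o -> i = l by case: i => -[|[|]] // Hi _; apply: val_inj.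
have mm i : matched phi psi (E i i) (ff i).
  rewrite /ff; case: eqVneq => [->//|/two ->]; rewrite -E1.
  exact: (matchedC B_locmx F2 ui m).
have He := m_idem m; have Hf := m_idemV m.
have orth i j : i != j -> ff i * ff j = 0.
  rewrite /ff; case: (eqVneq i o) => [->|/two ->].
    by rewrite eq_sym => /negPf ->; rewrite idem_mulC.
  by case: (eqVneq j o) => [_ _|/two ->]; [rewrite idem_mulCl | rewrite eqxx].
pose x a := a *: E o l; pose y a := a *: E l o.
have Hx a : upper (E o o) (x a).
  by rewrite /upper E1; apply/cornerZ/mu_corner.
have Hy a : upper (1 - E o o) (y a).
  by rewrite /upper subr1K E1; apply/cornerZ/mu_corner.
pose X a := alpha (x a); pose Y a := alpha (y a).
have mC := matchedC B_locmx F2 ui m.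
have HX a : upper f (X a) := m_upper m (Hx a).
have HY a : upper (1 - f) (Y a) := m_upper mC (Hy a).
have XN a : X (- a) = - X a by rewrite /X /x scaleNr (shiftN m (Hx a)).
have YN a : Y (- a) = - Y a by rewrite /Y /y scaleNr (shiftN mC (Hy a)).
have xyE a b : x a * y b = (a * b) *: E o o.
  by rewrite /x /y -scalerAl -scalerAr scalerA (mu_mul1 muE).
have yxE a b : y a * x b = (a * b) *: (1 - E o o).
  by rewrite /x /y -scalerAl -scalerAr scalerA (mu_mul1 muE) E1.
have weyl a : a != 0 -> X a * Y a^-1 = f /\ Y a^-1 * X a = 1 - f.
  move=> a0; have [] := shift_weyl m (Hx a) (Hy (- a^-1)).
  - by rewrite xyE mulrN mulfV // scaleN1r.
  - by rewrite yxE mulNr mulVf // scaleN1r.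
  by rewrite -/(X _) -/(Y _) YN mulrN mulNr => /oppr_inj -> /oppr_inj ->.
have Xf a : X a * f = 0 /\ f * X a = X a by have /upperP[] := HX a.
have Yf a : f * Y a = 0 /\ Y a * f = Y a by have /upperCP[] := HY a.
have X1 a : (1 - f) * X a = 0 /\ X a * (1 - f) = X a.
  by have [h1 h2] := Xf a; rewrite (mulrBl _ 1 f) (mulrBr _ 1 f) mul1r mulr1 h1 h2 subr0 subrr.
pose G a := X a * Y 1.
have [XY1 YX1] := weyl 1 (oner_neq0 F); rewrite invr1 in XY1 YX1.
have GD : {morph G : a b / a + b}.
  move=> a b; have XD : X (a + b) = X a + X b.
    by rewrite /X {1}/x scalerDl; apply: (shiftD ui m (Hx a) (Hx b)).
  by rewrite /G XD (mulrDl (X a) (X b)).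
have G0 : G 0 = 0 by rewrite /G /X /x scale0r (shift0 ui) mul0r.
have G1 : G 1 = f by [].
(* h a = w(a) w(-1) = diag(a, a^-1), where w(a) is the Weyl element of x a and y (- a^-1) *)
pose w a := x a + y (- a^-1); pose h a := w a * w (-1).
have phiw a : a != 0 -> w a \is a GRing.unit /\ phi (w a) = X a - Y a^-1.
  move=> a0; have Ux := unit_upper He (Hx a).
  have Uy := unit_upper (m_idem mC) (Hy (- a^-1)).
  have xy : x a * y (- a^-1) = - E o o by rewrite xyE mulrN mulfV // scaleN1r.
  have yx : y (- a^-1) * x a = - (1 - E o o) by rewrite yxE mulNr mulVf // scaleN1r.
  rewrite /w -(weyl_eq He (Hx a) (Hy _) xy yx); split; first by rewrite unitrMl // unitrMl.
  rewrite !(uiM ui) ?unitrMl // !(shiftE phi) -/(X a) -/(Y _) YN.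
  have [h1 h2] := weyl a a0; rewrite (weyl_eq Hf (HX a)) ?mulrN ?mulNr ?h1 ?h2 //.
  exact/cornerN/HY.
pose K a := Y a^-1 * X 1.
have phih a : a != 0 -> h a \is a GRing.unit /\ phi (h a) = G a + K a.
  move=> a0; have [U1 P1] := phiw a a0.
  have [U2 P2] : w (-1) \is a GRing.unit /\ phi (w (-1)) = X (-1) - Y (-1)^-1.
    by apply: phiw; rewrite oppr_eq0 oner_eq0.
  split; first by rewrite unitrMl.
  rewrite (uiM ui) // P1 P2 invrN invr1 XN YN opprK /G /K.
  have -> : (X a - Y a^-1) * (- X 1 + Y 1) =
     X a * Y 1 + Y a^-1 * X 1 - X a * X 1 - Y a^-1 * Y 1 by ncring.
  by rewrite (upper_mul0 Hf (HX _) (HX _)) (upper_mul0 (idemC Hf) (HY _) (HY _)) !subr0.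
have hE a : h a = a *: E o o + a^-1 *: E l l.
  rewrite /h /w invrN invr1 opprK; have -> : (x a + y (- a^-1)) * (x (-1) + y 1) =
     x a * x (-1) + x a * y 1 + y (- a^-1) * x (-1) + y (- a^-1) * y 1 by ncring.
  rewrite (upper_mul0 He (Hx _) (Hx _)) (upper_mul0 (idemC He) (Hy _) (Hy _)).
  rewrite add0r addr0 xyE yxE E1.
  by rewrite mulrNN !mulr1.
have fG a : f * G a = G a by rewrite /G mulrA (Xf a).2.
have Gf a : G a * f = G a by rewrite /G -mulrA (Yf _).2.
have Kf a : K a * f = 0 by rewrite /K -mulrA (Xf _).1 mulr0.
have fK a : f * K a = 0 by rewrite /K mulrA (Yf _).1 mul0r.
(* For nonzero a, G a is the f-corner of phi(h a), whose other block is K a. *)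
have GC a b : G a * G b = G b * G a.
  case: (eqVneq a 0) => [->|a0]; first by rewrite G0 mul0r mulr0.
  case: (eqVneq b 0) => [->|b0]; first by rewrite G0 mul0r mulr0.
  have [Ua Pa] := phih a a0; have [Ub Pb] := phih b b0.
  have hC : h a * h b = h b * h a.
    rewrite !hE !(mulrDl, mulrDr) -!scalerAl -!scalerAr !scalerA.
    by rewrite !(mu_mul muE) /= !scaler0 (mulrC a) (mulrC a^-1).
  have := congr1 (fun z => f * phi z * f) hC; rewrite /= (uiM ui Ua Ub) (uiM ui Ub Ua) Pa Pb.
  have D c d : f * ((G c + K c) * (G d + K d)) * f = G c * G d.
    have -> : f * ((G c + K c) * (G d + K d)) * f =
       f * G c * (G d * f) + f * K c * ((G d + K d) * f) + f * G c * (K d * f) by ncring.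
    by rewrite fG Gf fK Kf mul0r mulr0 !addr0.
  by rewrite !D.
(* Conjugating 1 + x 1 by h a gives 1 + x (a * a), hence G a X 1 = X (a * a) K a. In the corner of
   1-f, K a has right inverse Y 1 X a, which allows solving for X (a * a). *)
have Gsq a : G (a * a) = G a * G a.
  case: (eqVneq a 0) => [->|a0]; first by rewrite mulr0 G0 mulr0.
  have [Ua Pa] := phih a a0.
  have Ux b : 1 + x b \is a GRing.unit := unit_upper He (Hx b).
  have conj : h a * (1 + x 1) = (1 + x (a * a)) * h a.
    rewrite mulrDr mulrDl mulr1 mul1r; congr (_ + _).
    rewrite hE /x mulrDl mulrDr -!scalerAl -!scalerAr !scalerA !(mu_mul muE) /=.
    by rewrite !scaler0 add0r addr0 mulr1 mulfK.
  have := congr1 phi conj; rewrite (uiM ui Ua (Ux 1)) (uiM ui (Ux _) Ua) Pa !(shiftE phi) -/(X _) -/(X _).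
  rewrite (mulrDr _ 1 (X 1)) (mulrDl 1 (X _)) mulr1 mul1r => /addrI.
  have -> : (G a + K a) * X 1 = G a * X 1.
    by rewrite (mulrDl (G a) (K a)) /K -mulrA (upper_mul0 Hf (HX _) (HX _)) mulr0 addr0.
  have -> : X (a * a) * (G a + K a) = X (a * a) * K a.
    by rewrite (mulrDr _ (G a)) /G !mulrA (upper_mul0 Hf (HX _) (HX _)) mul0r add0r.
  move=> H; have KY : K a * (Y 1 * X a) = 1 - f.
    transitivity (Y a^-1 * (X 1 * Y 1) * X a); first by rewrite /K !mulrA.
    by rewrite XY1 -mulrA (Xf a).2 (weyl a a0).2.
  transitivity (X (a * a) * (K a * (Y 1 * X a)) * Y 1).
    by rewrite KY (X1 _).2.
  transitivity (G a * (X 1 * Y 1) * (X a * Y 1)).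
    by rewrite (mulrA (X _) (K a)) -H !mulrA.
  by rewrite XY1 Gf.
have GM := jordan_mul GD Gsq GC.
have Y1 : (1 - f) * Y 1 = Y 1.
  by rewrite (mulrBl _ 1 f) mul1r (Yf 1).1 subr0.
have cas (P : 'I_2 -> Prop) : P o -> P l -> forall i, P i.
  by move=> Po Pl i; case: (eqVneq i o) => [->|/two ->].
have fE i j : frame phi E ff i j = if i == o then if j == o then f else X 1
    else if j == o then Y 1 else 1 - f.
  rewrite /frame /ff /X /Y /x /y !scale1r.
  by move: i; apply: (cas); move: j; apply: (cas).
have muF : matrix_units (frame phi E ff).
  split=> [i j k t|]; last first.
    by rewrite (bigD1 o) //= (bigD1 l) //= big1 ?addr0 ?fE ?subrKC // => -[[|[]]].
  rewrite !fE; have [h1 h2] := Xf 1; have [h3 h4] := Yf 1; have [h5 h6] := X1 1.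
  have h8 : Y 1 * (1 - f) = 0 by rewrite (mulrBr _ 1 f) mulr1 h4 subrr.
  by move: i; apply: (cas); move: j; apply: (cas); move: k; apply: (cas); move: t; apply: (cas);
    rewrite ?(idemC Hf) ?Hf ?h1 ?h2 ?h3 ?h4 ?h5 ?h6 ?Y1 ?h8 ?XY1 ?YX1
      ?(upper_mul0 Hf (HX _) (HX _)) ?(upper_mul0 (idemC Hf) (HY _) (HY _))
      ?(idem_mulC Hf) ?(idem_mulCl Hf).
have gamE a : gam phi E ff o l (a *: E o o) = G a.
  by rewrite /gam fE -scalerAl (mu_mul1 muE).
have cE c : corner (E o o) (E o o) c -> exists a, c = a *: E o o.
  by move=> [h1 h2]; have [a Ha] := scal c; exists a; rewrite -Ha h1 h2.
apply: (extension A_locmx B_locmx F2 ui muE lo mm orth muF).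
- move=> _ _ /cE[a ->] /cE[b ->].
  by rewrite -scalerAl -scalerAr scalerA (mu_mul1 muE) !gamE GM.
- by move=> j c /two -> _.
move=> j z /two -> Hz.
have [a Ha] := cE _ (corner_mul (mu_corner muE o l) Hz).
have -> : z = y a.
  by have [<- _] := Hz; rewrite -(mu_mul1 muE l o l) -mulrA Ha -scalerAr (mu_mul1 muE).
have -> : E o l * y a = a *: E o o by rewrite /y -scalerAr (mu_mul1 muE).
rewrite gamE fE /= -/(Y a); case: (eqVneq a 0) => [->|a0].
  by rewrite G0 mulr0 /Y /y scale0r (shift0 ui).
(* The Weyl relation at a^-1 inserts Y a X a^-1 = 1-f before Y 1, which turns the left side into Y a
   G a^-1 G a. *)
have aV0 : a^-1 != 0 by rewrite invr_eq0.
have [XYa YXa] := weyl _ aV0; rewrite invrK in XYa YXa.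
rewrite -Y1 -YXa; transitivity (Y a * (G a^-1 * G a)); first by rewrite /G !mulrA.
by rewrite -GM mulVf // G1 (Yf a).2.
Qed.


End RankTwo.

(** * Endomorphisms of the unit group fixing transvections *)

Section FixingTransvections.
Variables (F : fieldType) (A : unitAlgType F).
Hypothesis A_locmx : locally_matrix A.
Hypothesis F2 : 2%:R != 0 :> F.
Variables (psi : A -> A) (e : A).
Hypothesis psi_unit : forall x, x \is a GRing.unit -> psi x \is a GRing.unit.
Hypothesis psiM : forall x y, x \is a GRing.unit -> y \is a GRing.unit ->
  psi (x * y) = psi x * psi y.
Hypotheses (e_idem : idem e) (e0 : e <> 0) (e1 : 1 - e <> 0).
Hypothesis psi_upper : forall x, upper e x -> psi (1 + x) = 1 + x.
Hypothesis psi_lower : forall x, upper (1 - e) x -> psi (1 + x) = 1 + x.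

(** Such m normalises U_e and U_(1-e), which psi fixes pointwise, so m^-1 psi(m) centralises both
    groups and is scalar. *)
Lemma fixing_diagonal m : m \is a GRing.unit -> e * m = m * e ->
  exists c : F, psi m = c *: m.
Proof.
move=> Um em; have emV : e * m^-1 = m^-1 * e.
  by apply: (mulrI Um); apply: (mulIr Um); rewrite mulVKr // -!mulrA mulVr // mulr1 em.
have half g x : idem g -> g * m = m * g -> g * m^-1 = m^-1 * g ->
    (forall x, upper g x -> psi (1 + x) = 1 + x) ->
    upper g x -> m^-1 * psi m * x = x * (m^-1 * psi m).
  move=> Hg gm gmV Hpsi Hx; have /upperP[gx xg] := Hx.
  have Hx' : upper g (m * x * m^-1).
    apply/upperP; split; first by rewrite !mulrA gm -(mulrA m g) gx.
    by rewrite -!mulrA -gmV (mulrA x) xg mul0r mulr0.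
  have Ux := unit_upper Hg Hx; have Ux' := unit_upper Hg Hx'.
  have : psi (m * (1 + x)) = psi ((1 + m * x * m^-1) * m).
    by rewrite mulrDr mulrDl mulr1 mul1r mulrVK.
  rewrite !psiM // !Hpsi // mulrDr mulrDl mulr1 mul1r => /addrI H.
  by rewrite -mulrA H !mulrA mulVr // mul1r.
have cm : (1 - e) * m = m * (1 - e) by rewrite mulrBl mulrBr mul1r mulr1 em.
have cmV : (1 - e) * m^-1 = m^-1 * (1 - e) by rewrite mulrBl mulrBr mul1r mulr1 emV.
have [x Hx|x Hx|c Hc] := @upper_cent_scalar _ _ A_locmx e (m^-1 * psi m) e_idem e0 e1.
- exact: (half e).
- exact: (half (1 - e) x (idemC e_idem)).
by exists c; rewrite -[psi m](mulVKr Um) Hc -scalerAr mulr1.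
Qed.

(* Block LDU decomposition of 1 + x along g; the pivot g + g x g has inverse
   g - (1 + t)^-1 g x g in gAg. *)
Lemma fixing_big_cell g x (t : F) : g = e \/ g = 1 - e ->
  x * x = 0 -> x * g * x = t *: x -> 1 + t != 0 -> exists c : F, psi (1 + x) = c *: (1 + x).
Proof.
move=> ge xx xgx t1; have [Ux _] := unit_sqr0 xx.
have Hg : idem g by case: ge => ->; last exact: idemC.
pose s := (1 + t)^-1; pose y := s *: (g * x * (1 - g)); pose z := s *: ((1 - g) * x * g).
have Hy : upper g y by apply/cornerZ/cornerM/idemC.
have Hz : upper (1 - g) z.
  by apply/cornerZ; rewrite subr1K; apply/cornerM => //; apply: idemC.
have Uy := unit_upper Hg Hy; have Uz := unit_upper (idemC Hg) Hz.
have [_ yV] := unit_sqr0 (upper_sqr Hg Hy); have [_ zV] := unit_sqr0 (upper_sqr (idemC Hg) Hz).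
pose m := (1 - z) * (1 + x) * (1 - y).
have Um : m \is a GRing.unit by rewrite /m -yV -zV unitrMl ?unitrV // unitrMl // unitrV.
have xE : 1 + x = (1 + z) * m * (1 + y).
  by rewrite /m -yV -zV !mulrA mulrV // mul1r mulrVK.
have s1 : s * (1 + t) = 1 by rewrite /s mulVf.
have [gy yg] := (upperP g y).1 Hy; have [gz zg] := (upperCP g z).1 Hz.
have top : g * m * (1 - g) = 0.
  have -> : g * m * (1 - g) = g * x * (1 - g) - g * y - g * x * y + (g - g * g)
     + g * (y * g) + g * x * (y * g) - g * z * ((1 + x) * (1 - y) * (1 - g)).
    by rewrite /m; ncring.
  rewrite gy yg gz Hg subrr mul0r !mulr0 subr0 !addr0.
  have -> : g * x * y = (s * t) *: (g * x * (1 - g)).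
    rewrite /y -scalerAr -scalerA; congr (_ *: _).
    have -> : g * x * (g * x * (1 - g)) = g * (x * g * x) * (1 - g) by rewrite !mulrA.
    by rewrite xgx -scalerAr -scalerAl.
  rewrite /y -{1}(scale1r (g * x * _)) -!scalerBl -{1}s1 mulrDr mulr1.
  by rewrite -addrA -opprD subrr scale0r.
have bot : (1 - g) * m * g = 0.
  have -> : (1 - g) * m * g = (1 - g) * x * g - z * g - z * x * g + (g - g * g)
     + g * z * g + g * z * x * g - (1 - g) * (1 - z) * (1 + x) * (y * g).
    by rewrite /m; ncring.
  rewrite yg gz zg Hg subrr !mul0r mulr0 subr0 !addr0.
  have -> : z * x * g = (s * t) *: ((1 - g) * x * g).
    rewrite /z -!scalerAl -scalerA; congr (_ *: _).
    have -> : (1 - g) * x * g * x * g = (1 - g) * (x * g * x) * g by rewrite !mulrA.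
    by rewrite xgx -scalerAr -scalerAl.
  rewrite /z -{1}(scale1r (_ * x * g)) -!scalerBl -{1}s1 mulrDr mulr1.
  by rewrite -addrA -opprD subrr scale0r.
have gm : g * m = m * g.
  have -> : g * m = g * m * (1 - g) + m * g - (1 - g) * m * g by ncring.
  by rewrite top bot add0r subr0.
have em : e * m = m * e.
  case: ge gm => -> // gm; have -> : e * m = m - (1 - e) * m by ncring.
  by rewrite gm; ncring.
have [c Hc] := fixing_diagonal Um em; exists c.
have [psiy psiz] : psi (1 + y) = 1 + y /\ psi (1 + z) = 1 + z.
  case: ge => gE; move: Hy Hz; rewrite gE ?subr1K => Hy' Hz';
    split; by [exact: psi_upper | exact: psi_lower].
have Uzm : (1 + z) * m \is a GRing.unit by rewrite unitrMl.
by rewrite xE (psiM Uzm Uy) (psiM Uz Um) psiy psiz Hc -scalerAr -scalerAl.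
Qed.

(** The big cell along e is missed only if t = -1. Since x(1-e)x = -tx, the pivot along 1-e is then
    governed by 1-t = 2. *)
Lemma fixing_transvection x (t : F) : x * x = 0 -> x * e * x = t *: x ->
  exists c : F, psi (1 + x) = c *: (1 + x).
Proof.
move=> xx xex; case: (eqVneq (1 + t) 0) => [t1|].
  apply: (@fixing_big_cell (1 - e) x (- t)) => //; first by right.
    by rewrite mulrBr mulr1 mulrBl xx xex sub0r scaleNr.
  by apply: contra_neq F2 => t2; rewrite -[2%:R]/(1 + 1) -{1}(addrK t 1) t1 sub0r addrC.
exact: (fixing_big_cell (or_introl (erefl e)) xx xex).
Qed.

(** Applying psi to g(1+x) = (1+x')g, where x' = gxg^-1 and both transvections are only scaled,
    shows that h = g^-1 psi(g) commutes with 1+x up to a scalar; that scalar is then shown to be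
    trivial. *)
Lemma fixing_scalar g : g \is a GRing.unit -> exists c : F, psi g = c *: g.
Proof.
move=> Ug; have Upg := psi_unit Ug; pose h := g^-1 * psi g.
suff [c Hc] : exists c : F, h = c%:A.
  by exists c; rewrite -[psi g](mulVKr Ug) -/h Hc -scalerAr mulr1.
(* The choice of q makes x' e x' a multiple of x', so [fixing_transvection] covers x' as well as
   x. *)
apply: (locally_matrix_scalar A_locmx (p := e) (q := g^-1 * e * g)) => x xx [t xex] [t' xqx].
pose x' := g * x * g^-1.
have xx' : x' * x' = 0.
  have -> : x' * x' = g * x * (g^-1 * g) * x * g^-1 by rewrite /x' !mulrA.
  by rewrite mulVr // mulr1 -(mulrA g) xx mulr0 mul0r.
have xex' : x' * e * x' = t' *: x'.
  have -> : x' * e * x' = g * (x * (g^-1 * e * g) * x) * g^-1 by rewrite /x' !mulrA.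
  by rewrite xqx -scalerAr -scalerAl.
have [c Hc] := fixing_transvection xx xex; have [c' Hc'] := fixing_transvection xx' xex'.
have [Ux _] := unit_sqr0 xx; have [Ux' _] := unit_sqr0 xx'.
have nz (a : F) (v w : A) : w \is a GRing.unit -> w = a *: v -> a != 0.
  by move=> Uw E; apply: contraTneq Uw => a0; rewrite E a0 scale0r unitr0.
have c'0 := nz _ _ _ (psi_unit Ux') Hc'; have c0 := nz _ _ _ (psi_unit Ux) Hc.
have H : c *: (h * (1 + x)) = c' *: ((1 + x) * h).
  have : psi (g * (1 + x)) = psi ((1 + x') * g).
    by rewrite mulrDr mulrDl mulr1 mul1r /x' mulrVK.
  rewrite !psiM // Hc Hc' -scalerAr -scalerAl => E.
  transitivity (g^-1 * (c *: (psi g * (1 + x)))); first by rewrite -scalerAr /h !mulrA.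
  rewrite E -scalerAr /h; congr (_ *: _).
  rewrite mulrDl mulrDr mul1r mulrDl mul1r /x'; congr (_ + _).
  by rewrite !mulrA mulVr // mul1r.
have Uh : h \is a GRing.unit by rewrite unitrMl // unitrV.
have cc : x = 0 \/ c = c'.
  (* c (1 + y) = c' (1 + x) with x and y = h x h^-1 of square zero forces c = c' *)
  pose y := h * x * h^-1.
  have yy : y * y = 0.
    have -> : y * y = h * x * (h^-1 * h) * x * h^-1 by rewrite /y !mulrA.
    by rewrite mulVr // mulr1 -(mulrA h) xx mulr0 mul0r.
  have yE : c *: y = (c' - c) *: 1 + c' *: x.
    have : c *: (1 + y) = c' *: (1 + x).
      apply: (mulIr Uh); rewrite -!scalerAl -H; congr (_ *: _).
      by rewrite mulrDl mulrDr mul1r mulr1 /y mulrVK.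
    move=> E; have -> : (c' - c) *: 1 + c' *: x = c' *: (1 + x) - c *: 1.
      by rewrite scalerBl scalerDr addrAC.
    by rewrite -E scalerDr addrC addKr.
  have : (c *: y) * (c *: y) * x = 0.
    by rewrite -(scalerAl c y) -(scalerAr c y) yy !scaler0 mul0r.
  have -> : (c *: y) * (c *: y) * x = ((c' - c) * (c' - c)) *: x.
    rewrite yE -mulrA mulrDl -!scalerAl mul1r mulrDl -!scalerAl mul1r xx scaler0 addr0.
    by rewrite -scalerAr xx !scaler0 addr0 scalerA.
  move/eqP; rewrite scaler_eq0 mulf_eq0 orbb subr_eq0 => /orP[/eqP->|/eqP]; by [right|left].
case: cc H => [->|->]; first by rewrite mulr0 mul0r.
move/(scalerI c'0); rewrite mulrDr mulrDl mulr1 mul1r; exact: addrI.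
Qed.

End FixingTransvections.

(** * From agreement on transvections to the standard form *)

Section StandardForm.
Variables (F : fieldType) (A B : unitAlgType F).
Hypotheses (A_locmx : locally_matrix A) (B_locmx : locally_matrix B).
Hypothesis F2 : 2%:R != 0 :> F.
Variables (phi : A -> B) (psi : B -> A).
Hypothesis ui : unit_iso phi psi.

Lemma agree_standard e (theta : {rmorphism A -> B}) : idem e -> e <> 0 -> 1 - e <> 0 ->
  bijective theta -> agree phi e theta ->
  forall g, g \is a GRing.unit -> exists c : F, phi g = c *: theta g.
Proof.
move=> He e0 e1 [inv thK invK] [Hup Hlow] g Ug.
have th_inj := can_inj thK.
have fix_up x : theta x = shift phi x -> inv (phi (1 + x)) = 1 + x.
  by move=> E; apply: th_inj; rewrite invK rmorphD rmorph1 E /shift subrKC.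
have [||||a Ha] := @fixing_scalar _ _ A_locmx F2 (inv \o phi) e _ _ He e0 e1 _ _ g Ug.
- move=> x Ux /=; have Upx := ui_unit ui Ux.
  apply/unitrP; exists (inv (phi x)^-1).
  by split; apply: th_inj; rewrite rmorphM !invK rmorph1 ?mulrV ?mulVr.
- by move=> x y Ux Uy /=; apply: th_inj; rewrite rmorphM !invK (uiM ui).
- by move=> x Hx /=; apply/fix_up/Hup.
- by move=> x Hx /=; apply/fix_up/Hlow.
(* As theta need not be F-linear, the scalar a may change: its image is central because theta is
   onto, hence again a scalar c. *)
have [y _|c Hc] := @sqr0_cent_scalar _ _ B_locmx (theta a%:A).
  by rewrite -(invK y) -!rmorphM -scalerAl -scalerAr mul1r mulr1.
exists c; rewrite -[phi g]invK; move: Ha => /= ->.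
have -> : a *: g = a%:A * g by rewrite -scalerAl mul1r.
by rewrite rmorphM Hc -scalerAl mul1r.
Qed.

End StandardForm.

(** * Periodic matrices *)

Section PeriodicUnits.
Variables (F : fieldType) (s : steinitz).
Local Notation P := (periodic_mx F s).
Implicit Types x y : P.

Lemma pmx_inj x y : (forall p q, pmx x p q = pmx y p q) -> x = y.
Proof. by move=> e; apply/val_inj/funext => i; apply/funext => j; apply: e. Qed.

Lemma pmx_sum (I : Type) (r : seq I) (f : I -> P) p q :
  pmx (\sum_(i <- r) f i) p q = \sum_(i <- r) pmx (f i) p q.
Proof.
elim: r => [|i r IH]; first by rewrite !big_nil /= mul0rn.
by rewrite !big_cons -IH.
Qed.

Lemma pm_trD x y : pm_tr (x + y) = pm_tr x + pm_tr y.
Proof. exact: pmx_inj. Qed.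

Lemma pm_trK : involutive (@pm_tr F s).
Proof. by move=> x; apply: pmx_inj. Qed.

Lemma pm_trM x y : pm_tr (x * y) = pm_tr y * pm_tr x.
Proof.
apply: pmx_inj => p q; rewrite /= /infmx_tr /infmx_mul.
by apply: eq_fsbigr => k _; apply: mulrC.
Qed.

Lemma pm_tr1 : pm_tr 1 = 1 :> P.
Proof. by apply: pmx_inj => p q; rewrite /= /infmx_tr eq_sym. Qed.

Variable n : nat.
Hypothesis ns : nat_dvd_steinitz n s.

(** The block E_ij repeated along the diagonal: quotients by n number the blocks, and remainders
    give positions inside them. *)
Lemma pm_unit_periodic (i j : 'I_n) :
  (fun p q => ((p %/ n == q %/ n) && ((p %% n == i) && (q %% n == j)))%N%:R)
  \in s_periodic (F := F) s.
Proof.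
apply/asboolP; exists n; split=> //; apply/(n_periodicP _ ns.1) => p q.
rewrite !(divn_small (ltn_pmod _ ns.1)) eqxx !modn_mod.
by case: eqP.
Qed.

Definition pm_unit i j : P := PeriodicMx (pm_unit_periodic i j).

Lemma pm_tr_unit i j : pm_tr (pm_unit i j) = pm_unit j i.
Proof. by apply: pmx_inj => p q; rewrite /= /infmx_tr eq_sym [X in _ && X]andbC. Qed.

Lemma pm_unit_decomp x : n_periodic n (pmx x) ->
  x = \sum_(i < n) \sum_(j < n) pmx x i j *: pm_unit i j.
Proof.
move=> /(n_periodicP _ ns.1) Hx; apply: pmx_inj => p q; rewrite pmx_sum.
pose i := Ordinal (ltn_pmod p ns.1); pose j := Ordinal (ltn_pmod q ns.1).
rewrite (bigD1 i) //= [X in _ + X]big1 ?addr0 => [|k ki]; last first.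
  rewrite pmx_sum big1 // => l _ /=.
  by rewrite [_ == val k]eq_sym (negPf (ki : val k != val i)) andbF mulr0.
rewrite pmx_sum (bigD1 j) //= [X in _ + X]big1 ?addr0 => [|k kj]; last first.
  by rewrite [_ == val k]eq_sym (negPf (kj : val k != val j)) !andbF mulr0.
by rewrite !eqxx !andbT Hx; case: eqP; rewrite ?mulr1 ?mulr0.
Qed.

Lemma pm_matrix_units : matrix_units pm_unit.
Proof.
split=> [i j k l|].
  apply: pmx_inj => p q; rewrite /= /infmx_mul.
  (* The only summation index that can contribute: position j in the block of p. *)
  set r := (p %/ n * n + j)%N.
  have rd : (r %/ n = p %/ n)%N by rewrite /r divnMDl ?ns.1 // (divn_small (ltn_ord j)) addn0.
  have rm : (r %% n = j)%N by rewrite /r modnMDl modn_small.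
  rewrite (fsbigE [:: r]) //=; last first.
    move=> t _; rewrite inE => /negPf tr; case: eqP => [pt|]; last by rewrite mul0r.
    case: (eqVneq (t %% n)%N (j : nat)) => [tj|]; last by rewrite andbF mul0r.
    by move: tr; rewrite (divn_eq t n) -pt tj eqxx.
  rewrite big_mkcond big_seq1 classical_sets.in_setT rd rm !eqxx andbT /=.
  case: (eqVneq j k) => [<-|jk] /=.
    by rewrite eqxx /=; case: eqP; case: eqP; case: eqP; rewrite /= ?mulr0 ?mulr1.
  by rewrite (negPf (jk : val j != val k)) andbF mulr0 mul0rn.
apply: pmx_inj => p q; rewrite pmx_sum /=.
pose i := Ordinal (ltn_pmod p ns.1).
rewrite (bigD1 i) //= big1 ?addr0 => [|k ki]; last first.
  by rewrite [_ == val k]eq_sym (negPf (ki : val k != val i)) andbF.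
rewrite eqxx /= {3}(divn_eq p n) {3}(divn_eq q n).
congr (nat_of_bool _)%:R; case: eqP => [->|/eqP ne] /=; first by rewrite eqn_add2l eq_sym.
apply/esym/negbTE; apply: contraNneq ne => E.
have := congr1 (divn^~ n) E; rewrite !divnMDl ?ns.1 //.
by rewrite !(divn_small (ltn_pmod _ ns.1)) !addn0 => ->.
Qed.

End PeriodicUnits.

(** * Anti-involutions and the contragredient isomorphism *)

Record anti_involution (A : nzRingType) (tau : A -> A) : Prop := AntiInvolution {
  aiD : {morph tau : x y / x + y};
  aiM : forall x y, tau (x * y) = tau y * tau x;
  ai1 : tau 1 = 1;
  aiK : involutive tau }.

Section Contragredient.
Variables (F : fieldType) (A B : unitAlgType F) (tau : A -> A).
Variables (phi : A -> B) (psi : B -> A).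
Hypothesis ai : anti_involution tau.
Hypothesis ui : unit_iso phi psi.

Definition contra x := phi (tau x)^-1.
Definition contraV y := tau (psi y)^-1.

Lemma ai_unit x : x \is a GRing.unit -> tau x \is a GRing.unit.
Proof.
move=> Ux; apply/unitrP; exists (tau x^-1).
by rewrite -!(aiM ai) mulrV // mulVr // (ai1 ai).
Qed.

Lemma ai0 : tau 0 = 0.
Proof. by apply: (addrI (tau 0)); rewrite -(aiD ai) !addr0. Qed.

Lemma aiN x : tau (- x) = - tau x.
Proof. by apply/eqP; rewrite -subr_eq0 opprK -(aiD ai) addNr ai0. Qed.

Lemma contra_iso : unit_iso contra contraV.
Proof.
split.
- by move=> x Ux; rewrite /contra (ui_unit ui) ?unitrV ?ai_unit.
- by move=> y Uy; rewrite /contraV ai_unit ?unitrV ?(ui_unitV ui).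
- move=> x y Ux Uy; rewrite /contra (aiM ai) invrM ?ai_unit //.
  by rewrite (uiM ui) ?unitrV ?ai_unit.
- move=> x Ux; rewrite /contraV /contra (uiK ui) ?unitrV ?ai_unit //.
  by rewrite invrK (aiK ai).
- move=> y Uy; rewrite /contraV /contra (aiK ai) invrK (uiVK ui) //.
Qed.

Lemma ai_upper e x : tau e = e -> upper e x -> upper (1 - e) (- tau x).
Proof.
move=> te /upperP[ex xe]; apply/upperCP; rewrite mulrN mulNr -te -!(aiM ai).
by rewrite ex xe ai0 oppr0.
Qed.

Lemma contra_upper e x : tau e = e -> idem e -> upper e x ->
  contra (1 + x) = phi (1 - tau x).
Proof.
move=> te He Hx; rewrite /contra (aiD ai) (ai1 ai).
have [//|_ ->//] := @unit_sqr0 _ _ (tau x).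
by rewrite -(aiM ai) (upper_sqr He Hx) ai0.
Qed.

Lemma contraV_upper (f y : B) : idem f -> upper f y ->
  forall e, idem e -> tau e = e -> upper e (psi (1 + y) - 1) ->
  upper (1 - e) (contraV (1 + y) - 1).
Proof.
move=> Hf Hy e He te Hx; rewrite /contraV.
have -> : psi (1 + y) = 1 + (psi (1 + y) - 1) by rewrite subrKC.
have [_ ->] := unit_sqr0 (upper_sqr He Hx).
by rewrite (aiD ai) (ai1 ai) aiN add1K; apply: ai_upper.
Qed.

(** Inverse transpose fixes [refl e] but exchanges U_e and U_(1-e), so the partner of e becomes 1-f.
    This turns orthogonal complements into orthogonal idempotents. *)
Lemma matched_contra (e : A) (f : B) : tau e = e -> 
  matched phi psi e f -> matched contra contraV e (1 - f).
Proof.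
move=> te [He Hf Er H1 H2 H3 H4]; have He' := idemC He; have Hf' := idemC Hf.
have te' : tau (1 - e) = 1 - e by rewrite (aiD ai) (ai1 ai) aiN te.
split=> //.
- have -> : contra (refl e) = phi (refl e).
    have U := unit_involution (refl_sqr He).
    have -> : contra (refl e) = phi (refl e)^-1.
      by rewrite /contra /refl (aiD ai) aiN (aiD ai) (ai1 ai) te.
    by congr phi; apply: (mulrI U); rewrite mulrV // refl_sqr.
  by rewrite reflC; case: Er => ->; [right | left; rewrite opprK].
- by move=> x Hx; rewrite (contra_upper te He Hx); apply/H2/ai_upper.
- move=> x Hx; rewrite (contra_upper te' He' Hx) subr1K.
  by apply: H1; rewrite -(subr1K e); apply: ai_upper.
- move=> y Hy; rewrite -(subr1K e).
  by apply: (contraV_upper Hf' Hy He' te'); apply: H4.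
- rewrite subr1K => y Hy; apply: (contraV_upper Hf Hy He te); exact: H3.
Qed.

End Contragredient.

(** * The one-dimensional case *)

Section ScalarCase.
Variables (F : fieldType) (A B : unitAlgType F).
Hypothesis B_locmx : locally_matrix B.
Variables (phi : A -> B) (psi : B -> A).
Hypothesis ui : unit_iso phi psi.
Hypothesis A_scalar : forall x : A, exists c : F, x = c%:A.

(** The units of A commute, hence so do those of B. Square-zero elements of B therefore commute with
    one another, so they are scalar and zero, which makes all of B scalar. For theta the identity of
    F will do, since any two units differ by a scalar. *)
Lemma scalar_case : exists2 theta : {rmorphism A -> B}, bijective theta &
  forall g, g \is a GRing.unit -> exists c : F, phi g = c *: theta g.
Proof.
have AC (x y : A) : x * y = y * x.
  by have [c ->] := A_scalar x; rewrite -scalerAl -scalerAr mul1r mulr1.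
have uC (u v : B) : u \is a GRing.unit -> v \is a GRing.unit -> u * v = v * u.
  move=> Uu Uv; rewrite -(uiVK ui Uu) -(uiVK ui Uv).
  by rewrite -!(uiM ui) ?(ui_unitV ui) // AC.
have sqr0 (y : B) : y * y = 0 -> y = 0.
  move=> yy; have [z zz|c yc] := @sqr0_cent_scalar _ _ B_locmx y.
    have [Uy _] := unit_sqr0 yy; have [Uz _] := unit_sqr0 zz.
    have := uC _ _ Uy Uz.
    have -> : (1 + y) * (1 + z) = 1 + y + z + y * z by ncring.
    have -> : (1 + z) * (1 + y) = 1 + y + z + z * y by ncring.
    by move/addrI.
  move: yy; rewrite yc -scalerAl mul1r scalerA => /eqP.
  by rewrite scaler_eq0 oner_eq0 orbF mulf_eq0 orbb => /eqP ->; rewrite scale0r.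
have B_scalar (y : B) : exists c : F, y = c%:A.
  by apply: (sqr0_cent_scalar B_locmx) => x /sqr0 ->; rewrite mulr0 mul0r.
have [a aE] := choice A_scalar; have [b bE] := choice B_scalar.
have aI : injective (fun c : F => c%:A : A) by exact: fmorph_inj (in_alg A).
have bI : injective (fun c : F => c%:A : B) by exact: fmorph_inj (in_alg B).
pose th x : B := (a x)%:A.
have th_zmod : zmod_morphism th.
  move=> x y; rewrite /th -scalerBl; congr (_ *: _); apply: aI.
  by rewrite -aE scalerBl -!aE.
have th_monoid : monoid_morphism th.
  split=> [|x y]; first by rewrite /th -[RHS]scale1r; congr (_ *: _);
    apply: aI; rewrite -aE scale1r.
  rewrite /th -scalerAl mul1r scalerA; congr (_ *: _); apply: aI.
  by rewrite -aE {1}(aE x) {1}(aE y) -scalerAl mul1r scalerA.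
pose theta : {rmorphism A -> B} := HB.pack th
  (GRing.isZmodMorphism.Build A B th th_zmod)
  (GRing.isMonoidMorphism.Build A B th th_monoid).
exists theta.
  exists (fun y => (b y)%:A) => [x|y]; rewrite /= /th.
    by rewrite [RHS]aE; congr (_ *: _); apply: bI; rewrite -bE.
  by rewrite [RHS]bE; congr (_ *: _); apply: aI; rewrite -aE.
move=> g Ug; exists (b (phi g) / a g); rewrite /= /th scalerA mulfVK -?bE //.
by apply: contraTneq Ug => a0; rewrite (aE g) a0 scale0r unitr0.
Qed.

End ScalarCase.

(** * Factoring the scalars through the abelianization *)

Section Homothety.
Variables (F : fieldType) (G : groupType) (B : unitAlgType F).
Variables (phi T : G -> B).
Hypothesis phi_unit : forall g, phi g \is a GRing.unit.
Hypothesis phiM : forall g h, phi (g * h)%g = phi g * phi h.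
Hypothesis TM : forall g h, T (g * h)%g = T g * T h.
Hypothesis phiT : forall g, exists c : F, phi g = c *: T g.

(** As T(gh) is nonzero, the scalars c(g) multiply. Their values commute, so the kernel of c is a
    subgroup containing all commutators, and c descends to cosets. *)
Lemma homothety_ex :
  exists chi : {multiplicative abelianization G -> unit_group F},
  forall g, phi g = uval (chi (ab_class g)) *: T g.
Proof.
have [c cE] := choice phiT.
have c0 g : c g \is a GRing.unit.
  by rewrite unitfE; apply: contraTneq (phi_unit g) => c0; rewrite cE c0 scale0r unitr0.
have T0 g : T g != 0.
  by apply: contraTneq (phi_unit g) => T0; rewrite cE T0 scaler0 unitr0.
pose u g : unit_group F := UnitGroup (c0 g).
have uM : {morph u : g h / (g * h)%g}.
  move=> g h; apply: val_inj; rewrite /=; apply/eqP; rewrite -subr_eq0.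
  have : (c (g * h)%g - c g * c h) *: T (g * h)%g = 0.
    rewrite scalerBl -cE phiM !cE TM -scalerAl -scalerAr scalerA subrr //.
  by move/eqP; rewrite scaler_eq0 (negPf (T0 _)) orbF.
have u1 : u 1%g = 1%g by apply: (mulgI (u 1%g)); rewrite -uM !mulg1.
have uV g : u g^-1%g = (u g)^-1%g by apply: (mulgI (u g)); rewrite -uM !mulgV.
have uC (a b : unit_group F) : (a * b = b * a)%g by apply: val_inj; apply: mulrC.
have u_comm (x : G) : x \in @commutator_subgroup G -> u x = 1%g.
  move/asboolP => /(_ [pred x | u x == 1%g]) H; apply/eqP; apply: H.
    split=> [|g h]; rewrite !inE ?u1 //.
    by move=> /eqP ug /eqP uh; rewrite uM uV ug uh invg1 mulg1.
  move=> a b; rewrite inE /commg /conjg !uM !uV.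
  by rewrite [X in (_ * X)%g]uC mulgK mulVg.
have uE g : u (repr (ab_class g)) = u g.
  have /ab_classP/u_comm := ab_class_repr (ab_class g).
  rewrite uM uV => /(congr1 (fun z => u (repr (ab_class g)) * z)%g).
  by rewrite mulVKg mulg1.
pose chi (X : abelianization G) := u (repr X).
have chiM : {morph chi : X Y / (X * Y)%g}.
  move=> X Y; rewrite /chi -uM -[in LHS](ab_class_repr X) -[in LHS](ab_class_repr Y).
  by rewrite -gmulfM uE.
pose chi_hom : {multiplicative abelianization G -> unit_group F} :=
  HB.pack chi (isMultiplicative.Build _ _ chi chiM).
by exists chi_hom => g; have -> : chi_hom (ab_class g) = u g := uE g.
Qed.

End Homothety.

(** * Assembling the cases *)

Section MainTheorem.
Variables (F : fieldType) (A B : unitAlgType F).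
Hypotheses (F2 : 2%:R != 0 :> F) (F3 : 3%:R != 0 :> F).
Hypotheses (A_locmx : locally_matrix A) (B_locmx : locally_matrix B).

(** The system has size n+1, so [1 < n] means at least three diagonal units. Sizes one and two rely
    on the scalar corner. *)
Lemma unit_iso_standard (tau : A -> A) n (E : 'I_n.+1 -> 'I_n.+1 -> A)
    (phi : A -> B) (psi : B -> A) :
  anti_involution tau -> matrix_units E -> (forall i j, tau (E i j) = E j i) ->
  (1 < n)%N \/
    (forall x, exists c : F, E ord0 ord0 * x * E ord0 ord0 = c *: E ord0 ord0) ->
  unit_iso phi psi ->
  exists2 theta : {rmorphism A -> B}, bijective theta &
  (forall g, g \is a GRing.unit -> exists c : F, phi g = c *: theta g) \/
  (forall g, g \is a GRing.unit -> exists c : F, phi g = c *: theta (tau g^-1)).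
Proof.
move=> ai muE tauE En ui; case: (ltnP 1 n) => [n1|n1].
  case: n n1 E muE tauE {En} => [|[|m]] // _ E' muE' tauE'.
  have e0 := mu_neq0 muE' (i := ord0).
  have e1 : 1 - E' ord0 ord0 <> 0 by apply: (mu_neq1 muE' (j := ord_max)).
  have He := mu_idem muE' ord0.
  have [f [mf [orth|orth]]] := matched_family A_locmx B_locmx F2 F3 ui muE'.
    have [theta bij agr] := extension_ge3 A_locmx B_locmx F2 ui muE' mf orth.
    exists theta => //; left.
    exact: (agree_standard A_locmx B_locmx F2 ui He e0 e1 bij agr).
  have ui' := contra_iso ai ui.
  have mf' i : matched (contra tau phi) (contraV tau psi) (E' i i) (1 - f i).
    by apply: matched_contra => //; apply: tauE'.
  have [theta bij agr] := extension_ge3 A_locmx B_locmx F2 ui' muE' mf' orth.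
  exists theta => //; right=> g Ug.
  have Ut : tau g^-1 \is a GRing.unit by rewrite (ai_unit ai) ?unitrV.
  have [c Hc] := agree_standard A_locmx B_locmx F2 ui' He e0 e1 bij agr Ut.
  by exists c; rewrite -Hc /contra (aiK ai) invrK.
case: En => [|scal]; first by rewrite ltnNge n1.
case: n n1 E muE scal {tauE} => [|[|//]] _ E' muE' scal.
  have E1 : E' ord0 ord0 = 1 by rewrite -(mu_sum muE') big_ord1.
  have [x|theta bij H] := scalar_case B_locmx ui.
    by have [c] := scal x; rewrite E1 mul1r mulr1; exists c.
  by exists theta => //; left.
have e0 := mu_neq0 muE' (i := ord0).
have e1 : 1 - E' ord0 ord0 <> 0 by apply: (mu_neq1 muE' (j := ord_max)).
have He := mu_idem muE' ord0.
have [f mf] := matched_ex A_locmx B_locmx F2 F3 ui He e0 e1.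
have [theta bij agr] := extension_2 A_locmx B_locmx F2 ui muE' mf scal.
exists theta => //; left.
exact: (agree_standard A_locmx B_locmx F2 ui He e0 e1 bij agr).
Qed.

End MainTheorem.

(** If s has a divisor of at least 3, its matrix units serve. Otherwise every divisor is at most 2,
    so all elements have one common period, 2 or 1; the algebra is M_2(F) or F, with scalar
    corners. *)
Lemma periodic_matrix_units (F : fieldType) (s : steinitz) :
  exists (n : nat) (E : 'I_n.+1 -> 'I_n.+1 -> periodic_mx F s),
  [/\ matrix_units E, forall i j, pm_tr (E i j) = E j i &
    (1 < n)%N \/
    forall x, exists c : F, E ord0 ord0 * x * E ord0 ord0 = c *: E ord0 ord0].
Proof.
have small n (ns : nat_dvd_steinitz n.+1 s) :
    (forall x : periodic_mx F s, n_periodic n.+1 (pmx x)) ->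
    forall x, exists c : F, pm_unit F ns ord0 ord0 * x * pm_unit F ns ord0 ord0 =
      c *: pm_unit F ns ord0 ord0.
  move=> per x; have mu := pm_matrix_units F ns.
  exists (pmx x 0 0); rewrite {1}(pm_unit_decomp ns (per x)).
  rewrite mulr_sumr mulr_suml (bigD1 ord0) //= [X in _ + X]big1 ?addr0 => [|k k0].
    rewrite mulr_sumr mulr_suml (bigD1 ord0) //= [X in _ + X]big1 ?addr0 => [|k k0].
      by rewrite -scalerAr -scalerAl !(mu_mul1 mu).
    by rewrite -scalerAr -scalerAl -mulrA (mu_mul0 mu) // mulr0 scaler0.
  rewrite mulr_sumr mulr_suml big1 // => l _.
  by rewrite -scalerAr (mu_mul0 mu) 1?eq_sym // scaler0 mul0r.
case: (pselect (exists2 n, (1 < n)%N & nat_dvd_steinitz n.+1 s)) => [[n n1 ns]|no].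
  exists n, (pm_unit F ns); split; [exact: pm_matrix_units|exact: pm_tr_unit|by left].
have le2 n : nat_dvd_steinitz n s -> (n <= 2)%N.
  case: n => // n ns; rewrite leqNgt; apply/negP => n2.
  by apply: no; exists n.
case: (pselect (nat_dvd_steinitz 2 s)) => [s2|ns2].
  exists 1%N, (pm_unit F s2); split; [exact: pm_matrix_units|exact: pm_tr_unit|right].
  apply: small => x; have /asboolP[n [ns Hn]] := pmxP x.
  apply: (n_periodic_dvd _ _ Hn) => //.
  by case: n ns {Hn} (le2 n ns) => [[]|[|[|]]].
exists 0%N, (pm_unit F (nat_dvd_steinitz1 s)).
split; [exact: pm_matrix_units|exact: pm_tr_unit|right].
apply: small => x; have /asboolP[n [ns Hn]] := pmxP x.
by case: n ns Hn (le2 n ns) => [[]|[|[|]]].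
Qed.

Theorem theorem5 (F : fieldType)
    (char_neq2 : 2%N \notin [pchar F]) (char_neq3 : 3%N \notin [pchar F])
    (A B : unitAlgType F)
    (A_locmx : locally_matrix A) (A_count : countable_dimensional A)
    (B_locmx : locally_matrix B) (B_count : countable_dimensional B)
    (iota : {lrmorphism A -> periodic_mx F (steinitz_number A)})
    (iota_inv : periodic_mx F (steinitz_number A) -> A)
    (iotaK : cancel iota iota_inv) (iota_invK : cancel iota_inv iota)
    (phi : {multiplicative unit_group A -> unit_group B})
    (phi_bij : bijective phi) :
  exists (chi : {multiplicative abelianization (unit_group A) -> unit_group F})
         (theta : {rmorphism A -> B}),
    bijective theta /\
    ((forall g : unit_group A,
        uval (phi g) = uval (chi (ab_class g)) *: theta (uval g)) \/
     (forall g : unit_group A,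
        uval (phi g) = uval (chi (ab_class g)) *:
                         theta (iota_inv (pm_tr (iota (uval (g^-1)%g)))))).
Proof.
have F2 : 2%:R != 0 :> F by move: char_neq2; rewrite inE.
have F3 : 3%:R != 0 :> F by move: char_neq3; rewrite inE.
have iotaI := can_inj iotaK.
have iotaD x y : iota (x + y) = iota x + iota y by exact: rmorphD.
have iotaM x y : iota (x * y) = iota x * iota y by exact: rmorphM.
have iota1 : iota 1 = 1 by exact: rmorph1.
have [n [E [muE trE En]]] := periodic_matrix_units F (steinitz_number A).
pose tau x := iota_inv (pm_tr (iota x)).
have ai : anti_involution tau.
  split=> [x y|x y||x]; apply: iotaI; rewrite /tau.
  - by rewrite !iotaD !iota_invK pm_trD.
  - by rewrite !iotaM !iota_invK pm_trM.
  - by rewrite iota_invK iota1 pm_tr1.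
  - by rewrite !iota_invK pm_trK.
pose E' i j := iota_inv (E i j).
have muE' : matrix_units E'.
  split=> [i j k l|]; apply: iotaI.
    rewrite iotaM !iota_invK (mu_mul muE); case: eqP => _; last by rewrite rmorph0.
    by rewrite iota_invK.
  by rewrite rmorph_sum iota1 -(mu_sum muE); apply: eq_bigr => i _; apply: iota_invK.
have tauE i j : tau (E' i j) = E' j i by rewrite /tau /E' iota_invK trE.
have E'n : (1 < n)%N \/
    forall x, exists c : F, E' ord0 ord0 * x * E' ord0 ord0 = c *: E' ord0 ord0.
  case: En => [n1|scal]; [by left|right=> x]; have [c Hc] := scal (iota x); exists c.
  by apply: iotaI; rewrite linearZ /= !iotaM !iota_invK.
have [phiV phiK phiVK] := phi_bij.
(* [insubd] replaces nonunits by 1, a harmless default because [unit_iso] constrains values at units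
   only. *)
pose Phi (x : A) := uval (phi (insubd (1%g : unit_group A) x)).
pose Psi (y : B) := uval (phiV (insubd (1%g : unit_group B) y)).
have PhiE g : Phi (uval g) = uval (phi g) by rewrite /Phi valKd.
have PsiE g : Psi (uval g) = uval (phiV g) by rewrite /Psi valKd.
have ui : unit_iso Phi Psi.
  split=> [x _|y _|x y Ux Uy|x Ux|y Uy].
  - exact: uvalP.
  - exact: uvalP.
  - rewrite -[x]/(uval (UnitGroup Ux)) -[y]/(uval (UnitGroup Uy)) -uvalM !PhiE.
    by rewrite gmulfM.
  - by rewrite -[x]/(uval (UnitGroup Ux)) PhiE PsiE phiK.
  - by rewrite -[y]/(uval (UnitGroup Uy)) PsiE PhiE phiVK.
have [theta bij] := unit_iso_standard F2 F3 A_locmx B_locmx ai muE' tauE E'n ui.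
have phiM g h : uval (phi (g * h)%g) = uval (phi g) * uval (phi h) by rewrite gmulfM.
case=> H.
  have [||||chi Hchi] := @homothety_ex F (unit_group A) B (fun g => uval (phi g)) (fun g => theta (uval g)).
  - by move=> g; apply: uvalP.
  - exact: phiM.
  - by move=> g h /=; rewrite rmorphM.
  - by move=> g /=; have [c Hc] := H _ (uvalP g); exists c; rewrite -Hc PhiE.
  by exists chi, theta; split=> //; left.
have [||||chi Hchi] := @homothety_ex F (unit_group A) B (fun g => uval (phi g))
  (fun g => theta (tau (uval g^-1%g))).
- by move=> g; apply: uvalP.
- exact: phiM.
- by move=> g h /=; rewrite invrM ?uvalP // (aiM ai) rmorphM.
- by move=> g /=; have [c Hc] := H _ (uvalP g); exists c; rewrite -Hc PhiE.
by exists chi, theta; split=> //; right.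
Qed.
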